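(* Let $p>1$. There exists a constant $C(p)$ depending only on $p$ such that the following holds. Let $M^n$ be a complete Riemannian manifold of dimension $n=1$, let $R,T>0$, $x_0\in M^n$, $t_0\in\mathbb{R}$, $M>0$, and suppose that $u\le M$ is a positive solution of the porous media equation $$u_t=\Delta(u^p)$$ in $Q_{R,T}=B(x_0,R)\times[t_0-T,t_0]\subset M^n\times(-\infty,\infty)$. Let $\delta>0$ be a constant, $G(u)=\frac{p}{p-1}u^{p-1}$ and $\alpha=\frac{p}{p-1}M^{p-1}(1+\delta)$. Then $$\sup_{(x,t)\in Q_{R/2,T/2}}\frac{|\nabla_xG(u(x,t))|}{\alpha-G(u(x,t))}\le C(p)\left(\frac{1+\delta}{\delta R}+\frac{1}{\sqrt{M^{p-1}\delta T}}\right).$$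
   Context: $\Delta$ and $\nabla_x$ are the Laplace-Beltrami operator and gradient in the space variable $x$. $B(x_0,R)$ is the geodesic ball of radius $R$ centred at $x_0$, and $Q_{R/2,T/2}=B(x_0,R/2)\times[t_0-T/2,t_0]$. $M$ (without superscript) is a real constant, not the manifold. A positive solution is a positive function, smooth enough to be a classical solution, satisfying the equation pointwise. *)

(* Defs.v *)
From HB Require Import structures.
From mathcomp Require Import all_boot all_order all_algebra.
From mathcomp Require Import all_classical all_reals all_analysis.

Set Implicit Arguments.
Unset Strict Implicit.
Unset Printing Implicit Defensive.

Import Order.TTheory GRing.Theory Num.Theory.
Import numFieldNormedType.Exports.

Local Open Scope ring_scope.
Local Open Scope classical_set_scope.

(* C^infinity on an open set A of the real line. *)
Definition smooth_on (R : realType) (A : set R) (f : R -> R) : Prop :=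
  forall (n : nat) (y : R), A y -> derivable (derive1n n f) y 1.

(* Smooth Riemannian manifold of dimension 1. In the chart [i], defined on
   [cdom i], the metric is [metric i y dy^2]; [param i] is the inverse of
   [coord i], and is meaningful on the open set [coord i @` cdom i] only.
   [chart_at x] is an arbitrary chart around [x]: the coordinate expressions
   evaluated in it below do not depend on this choice. Connectedness is not
   required. *)
Record riemannian1 (R : realType) := Riemannian1 {
  carrier :> topologicalType;
  carrier_hausdorff : hausdorff_space carrier;
  carrier_countable : @second_countable carrier;
  chart : Type;
  cdom : chart -> set carrier;
  coord : chart -> carrier -> R;
  param : chart -> R -> carrier;
  chart_at : carrier -> chart;
  chart_atP : forall x, cdom (chart_at x) x;
  cdom_open : forall i, open (cdom i);
  coord_open : forall i, open (coord i @` cdom i);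
  coordK : forall i x, cdom i x -> param i (coord i x) = x;
  coord_continuous : forall i x, cdom i x -> {for x, continuous (coord i)};
  param_continuous : forall i y, (coord i @` cdom i) y ->
    {for y, continuous (param i)};
  transition_smooth : forall i j,
    smooth_on (coord i @` (cdom i `&` cdom j)) (coord j \o param i);
  metric : chart -> R -> R;
  metric_gt0 : forall i y, (coord i @` cdom i) y -> 0 < metric i y;
  metric_smooth : forall i, smooth_on (coord i @` cdom i) (metric i);
  metric_transition : forall i j x, cdom i x -> cdom j x ->
    metric i (coord i x) =
    metric j (coord j x) * derive1 (coord j \o param i) (coord i x) ^+ 2
}.

Arguments cdom {R} _ _.
Arguments coord {R} _ _.
Arguments param {R} _ _.
Arguments chart_at {R} _ _.
Arguments metric {R} _ _.

Section Geometry.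
Context {R : realType} (X : riemannian1 R).

Definition grad_norm (f : X -> R) (x : X) : R :=
  let i := chart_at X x in let y := coord X i x in
  `|derive1 (f \o param X i) y| / Num.sqrt (metric X i y).

(* Laplace-Beltrami operator: |g|^(-1/2) d/dy (|g|^(1/2) g^(-1) df/dy). *)
Definition laplacian (f : X -> R) (x : X) : R :=
  let i := chart_at X x in
  let g := metric X i in
  derive1 (fun y => Num.sqrt (g y) * (g y)^-1 * derive1 (f \o param X i) y)
    (coord X i x) / Num.sqrt (g (coord X i x)).

Definition speed (c : R -> X) (t : R) : R :=
  let i := chart_at X (c t) in
  Num.sqrt (metric X i (coord X i (c t))) * `|derive1 (coord X i \o c) t|.

Definition C1_curve_at (c : R -> X) (t : R) : Prop :=
  {for t, continuous c} /\
  forall i, cdom X i (c t) ->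
    (\forall s \near t, derivable (coord X i \o c) s 1) /\
    {for t, continuous (derive1 (coord X i \o c))}.

(* [path_length x y l]: some piecewise C^1 path from x to y has length l. *)
Inductive path_length : X -> X -> \bar R -> Prop :=
| path_C1 (c : R -> X) :
    (forall t, 0 <= t <= 1 -> C1_curve_at c t) ->
    path_length (c 0) (c 1)
      (\int[lebesgue_measure]_(t in `[0%R, 1%R]) (speed c t)%:E)%E
| path_cat (x y z : X) (l1 l2 : \bar R) :
    path_length x y l1 -> path_length y z l2 ->
    path_length x z (l1 + l2)%E.

(* Equal to +oo when x and y lie in different components. *)
Definition riem_dist (x y : X) : \bar R := ereal_inf (path_length x y).

Definition geodesic_ball (x0 : X) (r : R) : set X :=
  [set x | (riem_dist x0 x < r%:E)%E].

Definition cylinder (x0 : X) (t0 r T : R) : set (X * R) :=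
  [set z | geodesic_ball x0 r z.1 /\ t0 - T <= z.2 <= t0].

(* In dimension 1 the only Christoffel symbol is g' / (2 g). *)
Definition geodesic (c : R -> X) : Prop :=
  continuous c /\
  forall t i, cdom X i (c t) ->
    let y := coord X i \o c in let g := metric X i in
    [/\ derivable y t 1, derivable (derive1 y) t 1 &
        derive1n 2 y t + derive1 g (y t) / (2 * g (y t)) * derive1 y t ^+ 2 = 0].

(* Geodesic completeness: every initial position and velocity (v is the
   component of the velocity in the chart [chart_at X x]) is that of a geodesic
   defined for all times. By the Hopf-Rinow theorem this is equivalent to
   completeness of the distance. *)
Definition complete_manifold : Prop :=
  forall (x : X) (v : R), exists c : R -> X,
    [/\ geodesic c, c 0 = x & derive1 (coord X (chart_at X x) \o c) 0 = v].

Definition has_derivative_within (A : set R) (f : R -> R) (t l : R) : Prop :=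
  (fun s => (s - t)^-1 * (f s - f t)) @ within A t^' --> l.

(* Local expression of u is C^2 in space and C^1 in time, with all these
   derivatives jointly continuous on B x [a, b]; [ut] is the time derivative,
   one-sided at a and b. The set B is meant to be open. *)
Definition C21_on (B : set X) (a b : R) (u ut : X -> R -> R) : Prop :=
  (forall x t, B x -> a <= t <= b ->
     has_derivative_within `[a, b] (u x) t (ut x t)) /\
  forall i,
    let w := fun t y => u (param X i y) t in
    let V := coord X i @` (cdom X i `&` B) in
    let D := [set z : R * R | V z.1 /\ a <= z.2 <= b] in
    (forall t y, a <= t <= b -> V y ->
       derivable (w t) y 1 /\ derivable (derive1 (w t)) y 1) /\
    [/\ {within D, continuous (fun z : R * R => w z.2 z.1)},
        {within D, continuous (fun z : R * R => derive1 (w z.2) z.1)},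
        {within D, continuous (fun z : R * R => derive1n 2 (w z.2) z.1)} &
        {within D, continuous (fun z : R * R => ut (param X i z.1) z.2)}].

Definition positive_pme_solution (p : R) (B : set X) (a b : R)
    (u : X -> R -> R) : Prop :=
  (forall x t, B x -> a <= t <= b -> 0 < u x t) /\
  exists ut : X -> R -> R, C21_on B a b u ut /\
    forall x t, B x -> a <= t <= b ->
      ut x t = laplacian (fun x' => u x' t `^ p) x.

End Geometry.

(* Main.v *)
(* Through each point of the half ball runs a unit speed geodesic, defined for
   all times by completeness; along it Delta becomes d^2/ds^2 and |grad| becomes
   |d/ds|, and a segment of length r / 2 on either side stays in the ball. This
   leaves a one-dimensional interior estimate on a cylinder around the point.

   Let P = G(u) be the pressure, m = G(M), alpha = m (1 + delta) and
   phi = - ln (alpha - P), so that the quantity to be bounded is |phi_x|. Since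
   phi_t = (p - 1) P phi_xx + (alpha - p P) phi_x^2, the slope phi_x formally
   satisfies a parabolic equation with the damping term - p (alpha - P) phi_x^3,
   and p (alpha - P) >= p delta m; hence it lies below an explicit supersolution
   K which is infinite on the parabolic boundary. Only C^{2,1} regularity is
   available, so phi_x cannot be differentiated twice. Instead, with Psi a
   primitive of K, the maximum principle is applied to the two-point function
   phi(y,t) - phi(x,t) - (Psi(y,t) - Psi(x,t)) on x <= y: at a positive maximum
   phi_x = K at both points, the second derivatives are ordered, and subtracting
   the two equations contradicts the choice of K. So phi - Psi is nonincreasing
   in x, that is phi_x <= K. *)
Require Import Defs.
From HB Require Import structures.
From mathcomp Require Import all_boot all_order all_algebra.
From mathcomp Require Import all_classical all_reals all_analysis.
From mathcomp Require Import ring lra.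
Import Order.TTheory GRing.Theory Num.Theory.
Import numFieldNormedType.Exports.
Local Open Scope ring_scope.
Local Open Scope classical_set_scope.

(** * Derivatives at a maximum *)

(** In Caratheodory's form the increment is [g y * (y - c)] with [g] continuous at [c] and
    [g c = d]; were [d] negative, [f] would exceed [f c] just left of [c]. Such one-sided maxima
    occur at the last time and at the ends of the space interval. *)
Lemma left_max_derive_ge0 (R : realType) (f : R -> R) (c d : R) :
  is_derive c 1 f d -> (\forall y \near c, y <= c -> f y <= f c) -> 0 <= d.
Proof.
move=> /is_derive1_caratheodory [g [fE gc gcd]] fmax.
rewrite leNgt; apply/negP => d0.
have gneg : \forall y \near c, g y < 0.
  by have /cvgr_lt := gc; apply; rewrite gcd.
have : \forall y \near c^'-, False.
  near=> y.
  have yc : y < c by near: y; exact: nbhs_left_lt.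
  have gy : g y < 0 by near: y; exact: cvg_within.
  have fy : y <= c -> f y <= f c by near: y; exact: cvg_within.
  have := fy (ltW yc); rewrite -subr_le0 fE => /le_lt_trans.
  have : 0 < g y * (y - c) by rewrite nmulr_rgt0// subr_lt0.
  by move=> h0 /(_ _ h0); rewrite ltxx.
by move=> /filter_ex[].
Unshelve. all: by end_near. Qed.

Lemma right_max_derive_le0 (R : realType) (f : R -> R) (c d : R) :
  is_derive c 1 f d -> (\forall y \near c, c <= y -> f y <= f c) -> d <= 0.
Proof.
move=> fd fmax; rewrite -oppr_ge0.
apply: (@left_max_derive_ge0 _ (fun y => f (- y)) (- c)).
  have := @is_derive1_comp _ f -%R (- c) d (- 1).
  rewrite opprK mulrN1; apply => //.
rewrite opprK.
have : (- y) @[y --> - c] --> c.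
  by rewrite -{2}(opprK c); apply: cvgN; exact: cvg_id.
move=> /(_ _ fmax) hh; apply: (@filterS _ (nbhs (- c)) _ _ _ _ hh) => y /= h yc.
by apply: h; rewrite lerNr.
Qed.

Lemma max_derive_eq0 (R : realType) (f : R -> R) (c d : R) :
  is_derive c 1 f d -> (\forall y \near c, f y <= f c) -> d = 0.
Proof.
move=> fd fmax; apply/eqP; rewrite eq_le.
apply/andP; split.
  by apply: (right_max_derive_le0 _ _ _ _ fd); apply: filterS fmax.
by apply: (left_max_derive_ge0 _ _ _ _ fd); apply: filterS fmax.
Qed.

(** The first derivative vanishes at [c]. If [d] were positive, [f'] would be positive just to the
    right of [c], and the mean value theorem would lift [f] above [f c]. *)
Lemma max_derive2_le0 (R : realType) (f f' : R -> R) (c d : R) :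
  (\forall y \near c, is_derive (y : R) 1 f (f' y)) -> is_derive c 1 f' d ->
  (\forall y \near c, f y <= f c) -> d <= 0.
Proof.
move=> fd f'd fmax.
have f'c : f' c = 0.
  by apply: (max_derive_eq0 _ _ _ _ _ fmax); exact: nbhs_singleton fd.
rewrite leNgt; apply/negP => d0.
move: f'd => /is_derive1_caratheodory [g [f'E gc gcd]].
have gpos : \forall y \near c, 0 < g y.
  by have /cvgr_gt := gc; apply; rewrite gcd.
have /nbhs_ballP [e /= e0 be] : \forall y \near c,
    [/\ is_derive (y : R) 1 f (f' y), f y <= f c & 0 < g y].
  near=> y; split; near: y; [exact: fd|exact: fmax|exact: gpos].
pose y := c + e / 2.
have cy : c < y by rewrite ltrDl divr_gt0.
have inb z : z \in `[c, y]%R ->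
    [/\ is_derive z 1 f (f' z), f z <= f c & 0 < g z].
  rewrite in_itv/= => /andP[cz zy]; apply: be; rewrite /ball/= ltr_norml.
  by move: zy; rewrite /y => zy; apply/andP; split; lra.
have [||z zcy] := @MVT _ f f' _ _ cy.
- by move=> x xcy; case: (inb x) => //; apply: subset_itv_oo_cc.
- apply: derivable_within_continuous => x xcy.
  by case: (inb x) => // -[].
have [_ _ gz] := inb z (subset_itv_oo_cc zcy).
have [_ fy _] := inb y (ltac:(by rewrite in_itv/= lexx ltW)).
have f'z : 0 < f' z.
  rewrite -[f' z]subr0 -[X in _ - X]f'c f'E mulr_gt0// subr_gt0.
  by move: zcy; rewrite in_itv/= => /andP[].
move=> E.
have : 0 < f y - f c by rewrite E mulr_gt0// subr_gt0.
by rewrite subr_gt0 ltNge fy.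
Unshelve. all: by end_near. Qed.

(* [g] is continued past [t] by its tangent line. *)
Lemma within_derivative_extension (R : realType) (a t l : R) (g : R -> R) :
  a < t -> has_derivative_within `[a, t] g t l ->
  exists h : R -> R, is_derive t 1 h l /\ forall s, s <= t -> h s = g s.
Proof.
move=> at_ gl.
pose h s := if s <= t then g s else g t + l * (s - t).
exists h; split; last by move=> s st; rewrite /h st.
(* Caratheodory's slope function of [h] at [t]; it is constantly [l] along the tangent. *)
pose q s := if s == t then l else if s <= t then (s - t)^-1 * (g s - g t) else l.
apply/is_derive1_caratheodory; exists q; split; last by rewrite /q eqxx.
- move=> z; rewrite /q /h lexx; case: eqP => [->|/eqP zt].
    by rewrite lexx !subrr mulr0.
  have zt0 : z - t != 0 by rewrite subr_eq0.
  by case: ifP => _; [rewrite mulrC mulVKf|rewrite addrAC subrr add0r].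
- apply/cvgrPdist_lt => e e0.
  move/cvgrPdist_lt : gl => /(_ _ e0).
  rewrite !near_withinE => gl.
  rewrite near_simpl/=; near=> s; rewrite /q eqxx; case: eqP => [_|/eqP st].
    by rewrite subrr normr0.
  case: ifP => [st'|_]; last by rewrite subrr normr0.
  have : s != t -> `[a, t]%classic s -> `|l - (s - t)^-1 * (g s - g t)| < e.
    by near: s; exact: gl.
  apply => //=; rewrite in_itv/= st' andbT; near: s.
  exact: lt_le_nbhsr.
Unshelve. all: by end_near. Qed.

(** * The barrier *)

(* For [x1 = 1 / (rho - x)], [x2 = 1 / (rho - y)], [y1 = 1 / (rho + x)] and
   [y2 = 1 / (rho + y)] with [x < y], [I], [S] and [T] are the increment of the
   barrier from [x] to [y] and the difference and the sum of its slopes; [Q] is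
   the slope at the pivot, the end point at which [W = max x2 y1] is attained. *)
Lemma pivot_estimates (R : realFieldType) (a rho k W x1 x2 y1 y2 h Q : R) :
  0 < a -> 0 < rho -> 0 <= k -> 0 <= h -> 1 <= rho * W ->
  0 <= x1 -> x1 <= x2 -> x2 <= W -> 0 <= y2 -> y2 <= y1 -> y1 <= W ->
  a * rho / 2 * W ^+ 2 + k <= Q ->
  let I := a * rho / 2 * ((x2 - x1) + (y1 - y2)) + k * h in
  let S := a * rho / 2 * ((x2 ^+ 2 + y2 ^+ 2) - (x1 ^+ 2 + y1 ^+ 2)) in
  let T := a * rho / 2 * ((x2 ^+ 2 + y2 ^+ 2) + (x1 ^+ 2 + y1 ^+ 2)) + 2 * k in
  [/\ k * h <= I, 0 <= T <= 4 * Q, a * `|S| <= 4 * Q * I,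
      a ^+ 2 * (a * rho * ((x2 ^+ 3 - y2 ^+ 3) - (x1 ^+ 3 - y1 ^+ 3)))
        <= 24 * Q ^+ 2 * I &
      forall u v, 0 <= u <= W -> 0 <= v <= W ->
        a * (a * rho * (u ^+ 3 - v ^+ 3)) <= 4 * Q ^+ 2].
Proof.
move=> a0 r0 k0 h0 rW x10 x12 x2W y20 y21 y1W WQ I S T.
have W0 : 0 <= W by apply: le_trans x2W; apply: le_trans x12.
have ar0 : 0 <= a * rho / 2 by rewrite divr_ge0// mulr_ge0// ltW.
have kh0 : 0 <= k * h by rewrite mulr_ge0.
set D := (x2 - x1) + (y1 - y2).
have D0 : 0 <= D by rewrite /D; lra.
have ID : a * rho / 2 * D <= I by rewrite /I -/D lerDl.
have I0 : 0 <= I by apply: le_trans ID; rewrite mulr_ge0.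
(* Here [1 <= rho * W] trades the length [rho] for a power of [W]. The bounds on [S] and on the
   increment of the cubes below are expressed through [a * W], hence through [Q]. *)
have aWQ : a * W <= 2 * Q.
  have : a * W * 1 <= a * W * (rho * W) by rewrite ler_wpM2l// mulr_ge0// ltW.
  have E : a * rho / 2 * W ^+ 2 = a * W * (rho * W) / 2 by field.
  by move: WQ k0; rewrite E mulr1 => *; lra.
have Q0 : 0 <= Q by apply: le_trans WQ; rewrite addr_ge0// mulr_ge0// exprn_ge0.
have sqW u : 0 <= u -> u <= W -> 0 <= u ^+ 2 <= W ^+ 2.
  by move=> u0 uW; rewrite exprn_ge0//= lerXn2r.
have cuW u : 0 <= u -> u <= W -> 0 <= u ^+ 3 <= W ^+ 3.
  by move=> u0 uW; rewrite exprn_ge0//= lerXn2r.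
split.
- by rewrite /I lerDr mulr_ge0.
- have /andP[x1a x1b] := sqW _ x10 (le_trans x12 x2W).
  have /andP[x2a x2b] := sqW _ (le_trans x10 x12) x2W.
  have /andP[y2a y2b] := sqW _ y20 (le_trans y21 y1W).
  have /andP[y1a y1b] := sqW _ (le_trans y20 y21) y1W.
  rewrite /T; set s := _ + _ + (_ + _).
  have s0 : 0 <= s by rewrite /s; lra.
  have sW : s <= 4 * W ^+ 2 by rewrite /s; lra.
  apply/andP; split; first by apply: addr_ge0; exact: mulr_ge0.
  have := ler_wpM2l ar0 sW; lra.
- have -> : S = a * rho / 2 * ((x2 - x1) * (x2 + x1) - (y1 - y2) * (y1 + y2)).
    by rewrite /S; field.
  rewrite normrM (ger0_norm ar0).
  have h1 : `|(x2 - x1) * (x2 + x1) - (y1 - y2) * (y1 + y2)| <= D * (2 * W).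
    have u1 : (x2 - x1) * (x2 + x1) <= (x2 - x1) * (2 * W).
      by rewrite ler_wpM2l; lra.
    have u2 : (y1 - y2) * (y1 + y2) <= (y1 - y2) * (2 * W).
      by rewrite ler_wpM2l; lra.
    have u3 : 0 <= (x2 - x1) * (x2 + x1).
      by rewrite mulr_ge0 ?subr_ge0// addr_ge0// (le_trans x10).
    have u4 : 0 <= (y1 - y2) * (y1 + y2).
      by rewrite mulr_ge0 ?subr_ge0// addr_ge0// (le_trans y20).
    rewrite ler_norml /D mulrDl; apply/andP; split; lra.
  have h2 : a * (a * rho / 2 * `|(x2 - x1) * (x2 + x1) - (y1 - y2) * (y1 + y2)|)
      <= 2 * (a * W) * I.
    apply: (@le_trans _ _ (a * (a * rho / 2 * (D * (2 * W))))).
      by rewrite ler_wpM2l ?(ltW a0)// ler_wpM2l.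
    have -> : a * (a * rho / 2 * (D * (2 * W))) = 2 * (a * W) * (a * rho / 2 * D).
      by field.
    by rewrite ler_wpM2l// mulr_ge0// mulr_ge0// ltW.
  apply: (le_trans h2); rewrite ler_wpM2r//; lra.
- have -> : (x2 ^+ 3 - y2 ^+ 3) - (x1 ^+ 3 - y1 ^+ 3) =
    (x2 - x1) * (x2 ^+ 2 + x2 * x1 + x1 ^+ 2) +
    (y1 - y2) * (y1 ^+ 2 + y1 * y2 + y2 ^+ 2) by field.
  have q u v : 0 <= u -> u <= W -> 0 <= v -> v <= W ->
      u ^+ 2 + u * v + v ^+ 2 <= 3 * W ^+ 2.
    move=> u0 uW v0 vW.
    have /andP[_ ?] := sqW _ u0 uW; have /andP[_ ?] := sqW _ v0 vW.
    have : u * v <= W * W by rewrite ler_pM.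
    rewrite -expr2; lra.
  have h1 : (x2 - x1) * (x2 ^+ 2 + x2 * x1 + x1 ^+ 2) +
    (y1 - y2) * (y1 ^+ 2 + y1 * y2 + y2 ^+ 2) <= D * (3 * W ^+ 2).
    rewrite [leRHS]mulrDl; apply: lerD.
      by rewrite ler_wpM2l ?subr_ge0// q// ?(le_trans x12)// (le_trans x10).
    by rewrite ler_wpM2l ?subr_ge0// q// ?(le_trans y21)// (le_trans y20).
  apply: (@le_trans _ _ (a ^+ 2 * (a * rho * (D * (3 * W ^+ 2))))).
    by rewrite ler_wpM2l ?exprn_ge0 ?(ltW a0)// ler_wpM2l// mulr_ge0// ltW.
  have -> : a ^+ 2 * (a * rho * (D * (3 * W ^+ 2))) =
    6 * (a * W) ^+ 2 * (a * rho / 2 * D) by field.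
  have aW0 : 0 <= a * W by rewrite mulr_ge0// ltW.
  have : (a * W) ^+ 2 <= 4 * Q ^+ 2.
    have -> : 4 * Q ^+ 2 = (2 * Q) ^+ 2 by field.
    by rewrite lerXn2r// ?nnegrE ?mulr_ge0.
  move=> h2; apply: ler_pM => //; last lra.
    by rewrite mulr_ge0// exprn_ge0.
  by rewrite mulr_ge0.
- move=> u v /andP[u0 uW] /andP[v0 vW].
  have /andP[? ?] := cuW _ u0 uW; have /andP[? ?] := cuW _ v0 vW.
  (* A spare factor [rho * W >= 1] completes the left side to four times the square of
     [a * rho / 2 * W ^+ 2], which is at most [Q]. *)
  have key : a * (a * rho * W ^+ 3) <= 4 * Q ^+ 2.
    apply: (@le_trans _ _ (4 * (a * rho / 2 * W ^+ 2) ^+ 2)).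
      have -> : 4 * (a * rho / 2 * W ^+ 2) ^+ 2 =
        a * (a * rho * W ^+ 3) * (rho * W) by field.
      rewrite ler_peMr//; rewrite !mulr_ge0 ?exprn_ge0// ltW//.
    rewrite ler_wpM2l// lerXn2r// ?nnegrE//.
      by rewrite mulr_ge0// exprn_ge0.
    by apply: le_trans WQ; rewrite lerDl.
  have aar : 0 <= a * (a * rho) by rewrite !mulr_ge0// ltW.
  have le1 : a * (a * rho) * (u ^+ 3 - v ^+ 3) <= a * (a * rho) * W ^+ 3.
    by rewrite ler_wpM2l//; lra.
  by rewrite mulrA; apply: (le_trans le1); rewrite -mulrA.
Qed.

(* [Po] is the pressure at the end point that is not the pivot, [DK] and [S]
   are the increments of the derivative and of the square of the slope of the
   barrier, and [Kp] is the derivative of that slope at the pivot. *)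
Lemma two_point_contradiction (R : realFieldType)
    (p m d a b k tau h I Q Px Py Po DK Kp S : R) :
  1 < p -> 0 < m -> 0 < d -> a = 96 * (1 + d) / d ->
  b ^+ 2 * (p * d * m) = 4 -> 0 < tau -> k ^+ 2 * tau = b ^+ 2 ->
  0 < k -> k <= Q -> 0 < h -> k * h <= I ->
  0 <= Po <= m -> d * m * I <= Py - Px ->
  a ^+ 2 * DK <= 24 * Q ^+ 2 * I -> a * Kp <= 4 * Q ^+ 2 ->
  a * `|S| <= 16 * Q ^+ 2 * I ->
  - (h * k / (2 * tau)) <= (p - 1) * Po * DK + (p - 1) * (Py - Px) * Kp
    + (m * (1 + d) - p * Po) * S - p * (Py - Px) * Q ^+ 2 -> False.
Proof.
move=> p1 m0 d0 aE bE tau0 kE k0 kQ h0 khI /andP[Po0 Pom] DlI DKb Kpb Sb.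
set Dl := Py - Px in DlI *.
have p0 : 0 < p by apply: lt_trans p1.
have p10 : 0 < p - 1 by rewrite subr_gt0.
have pdm : 0 < p * d * m by rewrite !mulr_gt0.
have I0 : 0 < I by apply: lt_le_trans khI; rewrite mulr_gt0.
have Q0 : 0 < Q by apply: lt_le_trans kQ.
have Q20 : 0 < Q ^+ 2 by rewrite exprn_gt0.
have Dl0 : 0 < Dl by apply: lt_le_trans DlI; rewrite !mulr_gt0.
have a96 : 96 <= a.
  by rewrite aE -mulrA ler_peMr// ler_pdivlMr// mul1r; lra.
have a0 : 0 < a by apply: lt_le_trans a96.
have ad : a * d = 96 * (1 + d) by rewrite aE divfK// gt_eqF.
(* The damping term [p * Dl * Q ^+ 2] is at least [E] by [e5]. The other terms amount to at most E/8
   + E/8 + E/6 and 1/24 of the damping term, in all 11/24 of it, which is absurd since [E] is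
   positive. *)
set E := p * d * m * Q ^+ 2 * I.
have E0 : 0 < E by rewrite /E !mulr_gt0.
have e1 : h * k / (2 * tau) <= E / 8.
  (* The normalisation of [b] turns the time derivative of the barrier, of order 1/tau, into a
     multiple of [k ^+ 2], comparable with [Q ^+ 2]. *)
  have tauE : tau^-1 = k ^+ 2 * (p * d * m) / 4.
    have k20 : k ^+ 2 != 0 by rewrite expf_neq0// gt_eqF.
    have tn0 : tau != 0 by rewrite gt_eqF.
    apply: (mulfI tn0); rewrite divff//.
    have -> : tau * (k ^+ 2 * (p * d * m) / 4) =
      k ^+ 2 * tau * (p * d * m) / 4 by field.
    by rewrite kE bE divff.
  rewrite invfM tauE.
  have -> : h * k * (2^-1 * (k ^+ 2 * (p * d * m) / 4)) =
    p * d * m / 8 * (k ^+ 2 * (k * h)) by field.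
  have -> : E / 8 = p * d * m / 8 * (Q ^+ 2 * I) by rewrite /E; field.
  rewrite ler_wpM2l//; first by rewrite divr_ge0// ltW.
  apply: ler_pM => //; first by rewrite exprn_ge0// ltW.
    by rewrite mulr_ge0// ltW.
  by rewrite lerXn2r// ?nnegrE ltW.
have e2 : (p - 1) * Po * DK <= E / 8.
  have a2d : 192 <= a ^+ 2 * d.
    have -> : a ^+ 2 * d = a * (a * d) by field.
    rewrite ad; have : 96 * (96 * (1 + d)) <= a * (96 * (1 + d)).
      by rewrite ler_wpM2r//; lra.
    lra.
  have DKE : DK <= d * Q ^+ 2 * I / 8.
    have a20 : 0 < a ^+ 2 by rewrite exprn_gt0.
    rewrite -(ler_pM2l a20); apply: (le_trans DKb).
    have -> : a ^+ 2 * (d * Q ^+ 2 * I / 8) = (a ^+ 2 * d) / 8 * (Q ^+ 2 * I) by field.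
    rewrite -mulrA ler_wpM2r//; first by rewrite mulr_ge0// ltW.
    lra.
  apply: (@le_trans _ _ ((p - 1) * Po * (d * Q ^+ 2 * I / 8))).
    by rewrite ler_wpM2l// mulr_ge0// ltW.
  have -> : E / 8 = p * m * (d * Q ^+ 2 * I / 8) by rewrite /E; field.
  rewrite ler_wpM2r//; first by rewrite !mulr_ge0// ltW.
  by rewrite ler_pM ?(ltW p10)// gerBl.
have e3 : (p - 1) * Dl * Kp <= p * Dl * Q ^+ 2 / 24.
  have KpE : Kp <= Q ^+ 2 / 24.
    rewrite -(ler_pM2l a0); apply: (le_trans Kpb).
    by have := ler_wpM2r (ltW Q20) a96; lra.
  apply: (@le_trans _ _ ((p - 1) * Dl * (Q ^+ 2 / 24))).
    by rewrite ler_wpM2l// mulr_ge0// ltW.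
  have : 0 <= Dl * (Q ^+ 2 / 24) by rewrite mulr_ge0 ?divr_ge0// ltW.
  lra.
have e4 : (m * (1 + d) - p * Po) * S <= E / 6.
  apply: (le_trans (ler_norm _)); rewrite normrM.
  have md : 0 <= m * (1 + d) by rewrite mulr_ge0// ?addr_ge0// ltW.
  have n1 : `|m * (1 + d) - p * Po| <= p * (m * (1 + d)).
    have u1 : m * (1 + d) <= p * (m * (1 + d)) by rewrite ler_peMl// ltW.
    have u2 : p * Po <= p * (m * (1 + d)).
      by rewrite ler_wpM2l ?(ltW p0)// (le_trans Pom)// ler_peMr ?(ltW m0)// lerDl ltW.
    have u3 : 0 <= p * Po by rewrite mulr_ge0// ltW.
    by rewrite ler_norml; apply/andP; split; lra.
  apply: (le_trans (ler_wpM2r (normr_ge0 _) n1)).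
  (* The choice of [a], that is [a * d = 96 * (1 + d)], absorbs the factor [1 + d] at this point. *)
  have -> : p * (m * (1 + d)) * `|S| = p * m * d / 96 * (a * `|S|).
    have -> : p * m * d / 96 * (a * `|S|) = p * m * (a * d) / 96 * `|S| by field.
    by rewrite ad; field.
  have -> : E / 6 = p * m * d / 96 * (16 * Q ^+ 2 * I) by rewrite /E; field.
  by rewrite ler_wpM2l// !mulr_ge0// ?ltW// (lt_trans _ p1).
have e5 : E <= p * Dl * Q ^+ 2.
  have -> : E = p * Q ^+ 2 * (d * m * I) by rewrite /E; field.
  have -> : p * Dl * Q ^+ 2 = p * Q ^+ 2 * Dl by field.
  by rewrite ler_wpM2l// mulr_ge0// ltW.
clear -e1 e2 e3 e4 e5 E0; lra.
Qed.

(* The slope [barrier_x] is a supersolution of the equation of the slope of the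
   logarithmic pressure; it is infinite at [x = rho], [x = - rho] and [t = s]. *)
Definition barrier {R : realType} (a rho b s x t : R) : R :=
  a * rho / 2 * ((rho - x)^-1 - (rho + x)^-1) + b / Num.sqrt (t - s) * x.

Definition barrier_x {R : realType} (a rho b s x t : R) : R :=
  a * rho / 2 * ((rho - x)^-1 ^+ 2 + (rho + x)^-1 ^+ 2) + b / Num.sqrt (t - s).

Definition barrier_xx {R : realType} (a rho x : R) : R :=
  a * rho * ((rho - x)^-1 ^+ 3 - (rho + x)^-1 ^+ 3).

Lemma is_derive_invB {R : realType} (rho x : R) : x < rho ->
  is_derive x 1 (fun y => (rho - y)^-1) ((rho - x)^-1 ^+ 2).
Proof.
move=> xr; have h : rho - x != 0 by rewrite gt_eqF// subr_gt0.
have d : is_derive x 1 (fun y => rho - y) (- 1).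
  by apply: is_derive_eq; ring.
have := @is_deriveV _ (fun y => rho - y) x _ 1 h d.
by rewrite /GRing.scale/= mulrN1 opprK exprVn.
Qed.

Lemma is_derive_invD {R : realType} (rho x : R) : - rho < x ->
  is_derive x 1 (fun y => (rho + y)^-1) (- (rho + x)^-1 ^+ 2).
Proof.
move=> xr; have h : rho + x != 0 by rewrite gt_eqF// -ltrBlDl sub0r.
have d : is_derive x 1 (fun y => rho + y) 1.
  by apply: is_derive_eq; ring.
have := @is_deriveV _ (fun y => rho + y) x _ 1 h d.
by rewrite /GRing.scale/= mulr1 exprVn.
Qed.

Lemma is_derive_barrier {R : realType} (a rho b s x t : R) : - rho < x < rho ->
  is_derive x 1 (barrier a rho b s ^~ t) (barrier_x a rho b s x t).
Proof.
move=> /andP[x1 x2]; rewrite /barrier /barrier_x.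
have := is_derive_invB _ _ x2; have := is_derive_invD _ _ x1 => d1 d2.
apply: is_derive_eq; rewrite /GRing.scale/=; ring.
Qed.

Lemma is_derive_barrier_x {R : realType} (a rho b s x t : R) :
  - rho < x < rho ->
  is_derive x 1 (barrier_x a rho b s ^~ t) (barrier_xx a rho x).
Proof.
move=> /andP[x1 x2]; rewrite /barrier_xx /barrier_x.
have := is_derive_invB _ _ x2; have := is_derive_invD _ _ x1 => d1 d2.
apply: is_derive_eq; rewrite /GRing.scale/=.
by field; rewrite !gt_eqF ?subr_gt0 -?ltrBlDl ?sub0r.
Qed.

Lemma is_derive_barrier_t {R : realType} (a rho b s x t : R) : s < t ->
  is_derive t 1 (barrier a rho b s x)
    (- (b / Num.sqrt (t - s) / (2 * (t - s)) * x)).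
Proof.
move=> st; rewrite /barrier.
have ts : 0 < t - s by rewrite subr_gt0.
have q0 : Num.sqrt (t - s) != 0 by rewrite gt_eqF// sqrtr_gt0.
have d1 : is_derive t 1 (fun y : R => Num.sqrt (y - s)) (2 * Num.sqrt (t - s))^-1.
  have ds : is_derive t 1 (fun y : R => y - s) 1.
    by apply: is_derive_eq; ring.
  have dq := is_derive1_sqrt ts.
  have := @is_derive1_comp _ Num.sqrt (fun y : R => y - s) t _ _ dq ds.
  by rewrite mulr1.
have d2 : is_derive t 1 (fun y : R => (Num.sqrt (y - s))^-1)
    (- (Num.sqrt (t - s)) ^- 2 *: (2 * Num.sqrt (t - s))^-1).
  exact: (@is_deriveV _ (fun y => Num.sqrt (y - s)) t _ 1 q0 d1).
apply: is_derive_eq; rewrite /GRing.scale/=.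
have tn0 : t - s != 0 by rewrite gt_eqF.
have wE := sqr_sqrtr (ltW ts).
move: (Num.sqrt (t - s)) q0 wE => w q0 wE; rewrite -wE {d1 d2}; field.
exact: q0.
Qed.

(** A discrete product rule reduces this to [two_point_contradiction]: an increment of products is
    split as the value of the pressure at one end point times the increment of the other factor,
    plus the increment of the pressure times the other factor at the pivot. The pivot is the end
    point closer to its own end of the interval, [- rho] for [x] and [rho] for [y], so that its
    slope [Q] dominates the error terms. *)
Lemma barrier_contradiction (R : realType)
    (p m d a b rho s t x y Px Py fx fy I : R) :
  1 < p -> 0 < m -> 0 < d -> 0 < b ->
  a = 96 * (1 + d) / d -> b ^+ 2 * (p * d * m) = 4 ->
  0 < rho -> - rho < x -> x < y -> y < rho -> s < t ->
  0 <= Px <= m -> 0 <= Py <= m ->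
  I = barrier a rho b s y t - barrier a rho b s x t ->
  (0 <= I -> d * m * I <= Py - Px) ->
  fy <= barrier_xx a rho y -> barrier_xx a rho x <= fx ->
  0 <= ((p - 1) * Py * fy + (m * (1 + d) - p * Py) * barrier_x a rho b s y t ^+ 2)
   - ((p - 1) * Px * fx + (m * (1 + d) - p * Px) * barrier_x a rho b s x t ^+ 2)
   - (- (b / Num.sqrt (t - s) / (2 * (t - s)) * y)
      - - (b / Num.sqrt (t - s) / (2 * (t - s)) * x)) -> False.
Proof.
move=> p1 m0 d0 b0 aE bE r0 xr xy yr st /andP[Px0 Pxm] /andP[Py0 Pym] IE gap cy cx.
have a0 : 0 < a by rewrite aE divr_gt0// mulr_gt0//; lra.
have ts : 0 < t - s by rewrite subr_gt0.
have fy' : (p - 1) * Py * fy <= (p - 1) * Py * barrier_xx a rho y.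
  by rewrite ler_wpM2l// mulr_ge0//; lra.
have fx' : (p - 1) * Px * barrier_xx a rho x <= (p - 1) * Px * fx.
  by rewrite ler_wpM2l// mulr_ge0//; lra.
set k := b / Num.sqrt (t - s).
have k0 : 0 < k by rewrite divr_gt0// sqrtr_gt0.
have kE : k ^+ 2 * (t - s) = b ^+ 2.
  by rewrite /k expr_div_n sqr_sqrtr ?divfK ?gt_eqF// ltW.
move: IE fy' fx'; rewrite /barrier /barrier_x /barrier_xx -/k.
set x1 := (rho - x)^-1; set x2 := (rho - y)^-1.
set y1 := (rho + x)^-1; set y2 := (rho + y)^-1.
move=> IE fy' fx' ineq.
have rx : 0 < rho - x by rewrite subr_gt0 (lt_trans xy).
have ry : 0 < rho - y by rewrite subr_gt0.
have rx' : 0 < rho + x by rewrite -ltrBlDl sub0r.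
have ry' : 0 < rho + y by rewrite (lt_trans rx')// ltrD2l.
have x10 : 0 < x1 by rewrite invr_gt0.
have y20 : 0 < y2 by rewrite invr_gt0.
have x12 : x1 <= x2 by rewrite lef_pV2 ?posrE// lerD2l lerN2 ltW.
have y21 : y2 <= y1 by rewrite lef_pV2 ?posrE// lerD2l ltW.
have h0 : 0 < y - x by rewrite subr_gt0.
(* Since [x < y], one of the distances [rho - y] and [rho + x] is at most [rho]: the first if
   [0 <= y], the second otherwise. *)
have rW : 1 <= rho * Num.max x2 y1.
  rewrite -ler_pdivrMl// mulr1 le_max.
  have [y0|y0] := leP 0 y; apply/orP; [left|right]; rewrite lef_pV2 ?posrE//.
    by rewrite gerBl.
  by rewrite gerDl ltW// (lt_trans xy).
have IE' : I = a * rho / 2 * ((x2 - x1) + (y1 - y2)) + k * (y - x).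
  by rewrite IE; ring.
clear IE.
set Kx := a * rho / 2 * (x1 ^+ 2 + y1 ^+ 2) + k in ineq.
set Ky := a * rho / 2 * (x2 ^+ 2 + y2 ^+ 2) + k in ineq.
set Hx := a * rho * (x1 ^+ 3 - y1 ^+ 3) in fx'.
set Hy := a * rho * (x2 ^+ 3 - y2 ^+ 3) in fy'.
have ar0 : 0 < a * rho / 2 by rewrite divr_gt0// mulr_gt0.
have kh0 : 0 <= k * (y - x) by rewrite mulr_ge0// ltW.
have kx : k <= Kx by rewrite lerDr mulr_ge0 ?(ltW ar0)// addr_ge0// exprn_even_ge0.
have ky : k <= Ky by rewrite lerDr mulr_ge0 ?(ltW ar0)// addr_ge0// exprn_even_ge0.
have [W [Q [rW' xW yW QW]]] : exists W Q, [/\ 1 <= rho * W, x2 <= W, y1 <= W &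
    a * rho / 2 * W ^+ 2 + k <= Q /\
    ((Q = Kx /\ y1 = W) \/ (Q = Ky /\ x2 = W))].
  have [yx|yx] := leP x2 y1.
    exists y1, Kx; split => //; first by rewrite (max_r yx) in rW.
    by split; [rewrite lerD2r ler_pM2l// lerDr exprn_even_ge0|left].
  exists x2, Ky; rewrite (ltW yx); split => //.
    by rewrite (max_l (ltW yx)) in rW.
  by split; [rewrite lerD2r ler_pM2l// lerDl exprn_even_ge0|right].
case: QW => QW piv.
have [kI /andP[T0 TQ] SQ DK Kp] := @pivot_estimates _ a rho k W x1 x2 y1 y2 (y - x) Q
  a0 r0 (ltW k0) (ltW h0) rW' (ltW x10) x12 xW (ltW y20) y21 yW QW.
rewrite -IE' in kI SQ DK.
have DKE : a * rho * (x2 ^+ 3 - y2 ^+ 3 - (x1 ^+ 3 - y1 ^+ 3)) = Hy - Hx.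
  by rewrite mulrBr.
rewrite DKE in DK.
(* The increment of the squared slopes is the difference of the slopes times their sum; the bounds 4
   Q I and 4 Q on these produce the constant 16. *)
have SE : Ky ^+ 2 - Kx ^+ 2 = a * rho / 2 * (x2 ^+ 2 + y2 ^+ 2 - (x1 ^+ 2 + y1 ^+ 2)) *
    (a * rho / 2 * (x2 ^+ 2 + y2 ^+ 2 + (x1 ^+ 2 + y1 ^+ 2)) + 2 * k).
  by rewrite /Ky /Kx; ring.
have I0 : 0 <= I by apply: le_trans kI.
have Q0 : 0 <= Q by case: piv => -[-> _]; [apply: le_trans kx|apply: le_trans ky]; exact: ltW.
have kQ : k <= Q by case: piv => -[-> _].
have Sb : a * `|Ky ^+ 2 - Kx ^+ 2| <= 16 * Q ^+ 2 * I.
  rewrite SE normrM (ger0_norm T0) mulrA.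
  have -> : 16 * Q ^+ 2 * I = 4 * Q * I * (4 * Q) by ring.
  by rewrite ler_pM// mulr_ge0// ltW.
have Hxb : y1 = W -> a * Hx <= 4 * Q ^+ 2.
  move=> yE; apply: Kp; first by rewrite (ltW x10) (le_trans x12).
  by rewrite yW andbT; apply: (le_trans (ltW y20)).
have Hyb : x2 = W -> a * Hy <= 4 * Q ^+ 2.
  move=> xE; apply: Kp; first by rewrite xW andbT; apply: (le_trans (ltW x10)).
  by rewrite (ltW y20) (le_trans y21).
have {}gap := gap I0.
have timeE : - (k / (2 * (t - s)) * y) - - (k / (2 * (t - s)) * x) =
   - ((y - x) * k / (2 * (t - s))) by ring.
rewrite timeE in ineq.
clear -p1 m0 d0 aE bE ts kE k0 kQ h0 kI gap DK Hxb Hyb Sb ineq piv fy' fx' Px0 Pxm Py0 Pym.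
case: piv => -[QE WE].
- apply: (two_point_contradiction _ _ _ _ _ _ _ _ _ _ _ Px Py Py _ _ _
    p1 m0 d0 aE bE ts kE k0 kQ h0 kI _ gap DK (Hxb WE) Sb).
    by rewrite Py0.
  rewrite QE; move: ineq; set e := (y - x) * k / _; clearbody e Kx Ky Hx Hy.
  clear -fy' fx'; lra.
- apply: (two_point_contradiction _ _ _ _ _ _ _ _ _ _ _ Px Py Px _ _ _
    p1 m0 d0 aE bE ts kE k0 kQ h0 kI _ gap DK (Hyb WE) Sb).
    by rewrite Px0.
  rewrite QE; move: ineq; set e := (y - x) * k / _; clearbody e Kx Ky Hx Hy.
  clear -fy' fx'; lra.
Qed.

(** * The two-point maximum principle *)

Lemma barrier_continuous (R : realType) (a rho b s x t : R) :
  - rho < x < rho -> s < t ->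
  barrier a rho b s z.1 z.2 @[z --> (x, t)] --> barrier a rho b s x t.
Proof.
move=> /andP[x1 x2] st; rewrite /barrier.
have c1 : (z.1 : R) @[z --> (x, t)] --> x by exact: cvg_fst.
have c2 : (z.2 : R) @[z --> (x, t)] --> t by exact: cvg_snd.
apply: cvgD.
  apply: cvgM; first exact: cvg_cst.
  apply: cvgB.
    apply: cvgV; first by rewrite gt_eqF// subr_gt0.
    by apply: cvgB => //; exact: cvg_cst.
  apply: cvgV; first by rewrite gt_eqF// -ltrBlDl sub0r.
  by apply: cvgD => //; exact: cvg_cst.
apply: cvgM => //; apply: cvgM; first exact: cvg_cst.
apply: cvgV; first by rewrite gt_eqF// sqrtr_gt0 subr_gt0.
apply: (cvg_comp _ Num.sqrt); last exact: sqrt_continuous.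
by apply: cvgB => //; exact: cvg_cst.
Qed.

(** The order of the two points is part of the domain; the two-point function vanishes on the
    diagonal edge, so a positive maximum has [x < y]. *)
Definition two_point_domain {R : realType} (r s t : R) : set (R * R * R) :=
  [set z | [/\ - r <= z.1.1, z.1.1 <= z.1.2, z.1.2 <= r & s <= z.2 <= t]].

Lemma compact_two_point_domain (R : realType) (r s t : R) :
  compact (two_point_domain r s t).
Proof.
have c1 : continuous (fun z : R * R * R => z.1.1).
  by move=> z; apply: (cvg_comp fst fst); exact: cvg_fst.
have c2 : continuous (fun z : R * R * R => z.1.2).
  by move=> z; apply: (cvg_comp fst snd); [exact: cvg_fst|exact: cvg_snd].
apply: (@subclosed_compact _ _ ((`[- r, r] `*` `[- r, r]) `*` `[s, t])).
- have -> : two_point_domain r s t =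
    ((`[- r, r] `*` `[- r, r]) `*` `[s, t]) `&`
    (fun z : R * R * R => z.1.2 - z.1.1) @^-1` [set u | 0 <= u].
    apply/seteqP; split => -[[x y] u]; rewrite /two_point_domain/= !in_itv/=.
      move=> [h1 h2 h3 h4]; rewrite h1 h3 h4 (le_trans h2 h3) (le_trans h1 h2).
      by rewrite subr_ge0.
    move=> [[[/andP[h1 h2] /andP[h3 h4]] h5]].
    by rewrite subr_ge0 => h6; split.
  apply: closedI.
    apply: compact_closed; first exact: norm_hausdorff.
    by apply: compact_setX; [apply: compact_setX|]; exact: segment_compact.
  apply: preimage_closed; last exact: closed_ge.
  by move=> z _; apply: cvgB; [exact: c2|exact: c1].
- by apply: compact_setX; [apply: compact_setX|]; exact: segment_compact.
- move=> [[x y] u]; rewrite /two_point_domain/= !in_itv/= => -[h1 h2 h3 h4].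
  by rewrite h1 h3 h4 (le_trans h2 h3) (le_trans h1 h2).
Qed.

(* [phi = - ln (alpha - P)], where the pressure [P] solves
   [P_t = (p - 1) P P_xx + P_x ^ 2] with [P <= m] and [alpha = m (1 + d)]; the
   time derivative is one-sided and is that of a two-sided continuation [h]. *)
Set Implicit Arguments.
Record log_pressure_at {R : realType} (p m d rho s t1 : R)
    (P phi phix phixx : R -> R -> R) (x t : R) : Prop := LogPressureAt {
  pressure_ge0 : 0 <= P x t;
  pressure_le : P x t <= m;
  log_pressureE : phi x t = - ln (m * (1 + d) - P x t);
  is_derive_log_pressure : is_derive x 1 (phi ^~ t) (phix x t);
  is_derive2_log_pressure : is_derive x 1 (phix ^~ t) (phixx x t);
  log_pressure_evolution : exists h : R -> R,
    is_derive t 1 h ((p - 1) * P x t * phixx x t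
                     + (m * (1 + d) - p * P x t) * phix x t ^+ 2) /\
    forall t', s <= t' <= t -> h t' = phi x t';
  log_pressure_continuous :
    phi z.1 z.2 @[z --> within [set z : R * R | - rho < z.1 < rho /\ s <= z.2 <= t1]
      (nbhs (x, t))] --> phi x t
}.
Unset Implicit Arguments.

Lemma cvg_within_within (T U : topologicalType) (A : set T) (B : set U)
    (f : T -> U) (x : T) (y : U) :
  f @ nbhs x --> y -> (\forall z \near x, A z -> B (f z)) ->
  f @ within A (nbhs x) --> within B (nbhs y).
Proof.
move=> fc AB W /fc h; apply: (@filterS2 _ (nbhs x) _ _ _ _ _ AB h) => z ABz Wz Az.
exact/Wz/ABz.
Qed.

(** With alpha = m (1 + d), the exponential of [phi2 - phi1] is (alpha - P1) / (alpha - P2), and it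
    is at least [1 + I]; hence P2 - P1 >= I (alpha - P2) >= I m d. This bounds the damping from
    below at a positive maximum. *)
Lemma log_pressure_gap (R : realType) (m d P1 P2 phi1 phi2 I : R) :
  0 < m -> 0 < d -> P1 <= m -> P2 <= m ->
  phi1 = - ln (m * (1 + d) - P1) -> phi2 = - ln (m * (1 + d) - P2) ->
  0 <= I -> I <= phi2 - phi1 -> d * m * I <= P2 - P1.
Proof.
move=> m0 d0 P1m P2m E1 E2 I0 Ile.
have md : 0 < m * d by rewrite mulr_gt0.
have a1 : 0 < m * (1 + d) - P1 by lra.
have a2 : 0 < m * (1 + d) - P2 by lra.
have e : expR (phi2 - phi1) = (m * (1 + d) - P1) / (m * (1 + d) - P2).
  by rewrite E1 E2 opprK expRD expRN !lnK ?posrE// mulrC.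
have := expR_ge1Dx (phi2 - phi1); rewrite e ler_pdivlMr// => h.
have h1 : (1 + I) * (m * (1 + d) - P2) <= m * (1 + d) - P1.
  by apply: le_trans h; rewrite ler_wpM2r ?(ltW a2)//; lra.
have h2 : I * (m * d) <= I * (m * (1 + d) - P2) by rewrite ler_wpM2l//; lra.
lra.
Qed.

Set Implicit Arguments.
Lemma is_derive_sub (R : realType) (f g : R -> R) (x df dg : R) :
  is_derive x 1 f df -> is_derive x 1 g dg ->
  is_derive x 1 (fun y => f y - g y) (df - dg).
Proof. by move=> h1 h2; exact: (is_deriveB h1 h2). Qed.
Unset Implicit Arguments.

(** The barrier is finite on the smaller closed cylinder given by [r < rho] and [s < s1], so a
    maximum exists. On its sides and at its initial time the barrier slope is at least [L], which
    [phix] stays strictly below; this keeps the maximum away from there. *)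
Lemma two_point_maximum_principle (R : realType) (p m d a b rho r L s s1 t1 : R)
    (P phi phix phixx : R -> R -> R) :
  1 < p -> 0 < m -> 0 < d -> 0 < b ->
  a = 96 * (1 + d) / d -> b ^+ 2 * (p * d * m) = 4 ->
  0 < r -> r < rho -> s < s1 -> s1 <= t1 ->
  (forall x t, - rho < x < rho -> s < t <= t1 ->
    log_pressure_at p m d rho s t1 P phi phix phixx x t) ->
  (forall x t, - r <= x <= r -> s1 <= t <= t1 -> phix x t < L) ->
  (forall t, s < t -> L <= barrier_x a rho b s r t) ->
  L <= b / Num.sqrt (s1 - s) ->
  forall x y t, two_point_domain r s1 t1 (x, y, t) ->
  phi y t - phi x t <= barrier a rho b s y t - barrier a rho b s x t.
Proof.
move=> p1 m0 d0 b0 aE bE r0 rr ss1 s1t1 sol phixL Kr Ks1.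
have a0 : 0 < a by rewrite aE divr_gt0// mulr_gt0//; lra.
have rho0 : 0 < rho by apply: lt_trans rr.
pose B := barrier a rho b s.
pose Z (z : R * R * R) := phi z.1.2 z.2 - phi z.1.1 z.2 - (B z.1.2 z.2 - B z.1.1 z.2).
pose Om := two_point_domain r s1 t1.
have inb x : - r <= x <= r -> - rho < x < rho by move=> /andP[??]; lra.
have int t : s1 <= t <= t1 -> s < t <= t1 by move=> /andP[??]; lra.
have Kbd t : s1 <= t <= t1 -> forall x, `|x| = r -> L <= barrier_x a rho b s x t.
  move=> t1t x /eqP; rewrite eqr_norml => /andP[/orP[] /eqP -> _].
    by apply: Kr; lra.
  have -> : barrier_x a rho b s (- r) t = barrier_x a rho b s r t.
    by rewrite /barrier_x opprK [X in _ * X]addrC.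
  by apply: Kr; lra.
have Kini x : L <= barrier_x a rho b s x s1.
  apply: (le_trans Ks1); rewrite /barrier_x lerDr mulr_ge0//.
    by rewrite divr_ge0// mulr_ge0// ltW.
  by rewrite addr_ge0// exprn_even_ge0.
have Zcont : {within Om, continuous Z}.
  apply/subspace_continuousP => -[[x y] t] [/= xr xy yr tt].
  have xI := inb x ltac:(lra); have yI := inb y ltac:(lra).
  have tI := int t tt.
  have pr1 : (z.1.1, z.2) @[z --> within Om (nbhs (x, y, t))] -->
      within [set z : R * R | - rho < z.1 < rho /\ s <= z.2 <= t1] (nbhs (x, t)).
    apply: cvg_within_within; last first.
      apply: (@filterE _ (nbhs (x, y, t)) _) => -[[x' y'] t'] [/= ? ? ? /andP[? ?]].
      by split; [apply: inb|]; lra.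
    apply: (@cvg_pair _ _ _ _ (nbhs x) (nbhs t) _ _ _ (fun z => z.1.1) snd).
      by apply: (cvg_comp fst fst); exact: cvg_fst.
    exact: cvg_snd.
  have pr2 : (z.1.2, z.2) @[z --> within Om (nbhs (x, y, t))] -->
      within [set z : R * R | - rho < z.1 < rho /\ s <= z.2 <= t1] (nbhs (y, t)).
    apply: cvg_within_within; last first.
      apply: (@filterE _ (nbhs (x, y, t)) _) => -[[x' y'] t'] [/= ? ? ? /andP[? ?]].
      by split; [apply: inb|]; lra.
    apply: (@cvg_pair _ _ _ _ (nbhs y) (nbhs t) _ _ _ (fun z => z.1.2) snd).
      by apply: (cvg_comp fst snd); [exact: cvg_fst|exact: cvg_snd].
    exact: cvg_snd.
  have st : s < t by case/andP: tI.
  have := log_pressure_continuous (sol x t xI tI) => cx.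
  have := log_pressure_continuous (sol y t yI tI) => cy.
  have bx : barrier a rho b s z.1 z.2 @[z -->
      within [set z : R * R | - rho < z.1 < rho /\ s <= z.2 <= t1]
        (nbhs (x, t))] --> barrier a rho b s x t.
    by apply: cvg_within_filter; exact: barrier_continuous.
  have b_y : barrier a rho b s z.1 z.2 @[z -->
      within [set z : R * R | - rho < z.1 < rho /\ s <= z.2 <= t1]
        (nbhs (y, t))] --> barrier a rho b s y t.
    by apply: cvg_within_filter; exact: barrier_continuous.
  rewrite /Z/=; apply: cvgB; apply: cvgB.
  - exact: (cvg_comp _ _ pr2 cy).
  - exact: (cvg_comp _ _ pr1 cx).
  - exact: (cvg_comp _ _ pr2 b_y).
  - exact: (cvg_comp _ _ pr1 bx).
have Om0 : Om !=set0 by exists (0, 0, s1); rewrite /Om/two_point_domain/=; split; lra.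
have [[[x y] t] + Zmax] := compact_EVT_max Om0 (compact_two_point_domain _ r s1 t1) Zcont.
rewrite inE => -[/= xr xy yr tt].
have Zle x' y' t' : - r <= x' -> x' <= y' -> y' <= r -> s1 <= t' <= t1 ->
    Z (x', y', t') <= Z (x, y, t).
  by move=> *; apply: Zmax; rewrite inE; split.
suff Zle0 : Z (x, y, t) <= 0.
  move=> x' y' t' [/= h1 h2 h3 h4]; rewrite -subr_le0.
  exact: le_trans (Zle x' y' t' h1 h2 h3 h4) Zle0.
rewrite leNgt; apply/negP => Z0.
have xy' : x < y.
  rewrite lt_neqAle xy andbT; apply/eqP => E; move: Z0.
  by rewrite /Z/= E !subrr ltxx.
have xI := inb x ltac:(lra); have yI := inb y ltac:(lra).
have tI := int t tt; have st : s < t by lra.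
have Sx := sol x t xI tI; have Sy := sol y t yI tI.
have := is_derive_log_pressure Sx; have := is_derive_log_pressure Sy => dphiy dphix.
have dBx := is_derive_barrier a rho b s _ t xI.
have dBy := is_derive_barrier a rho b s _ t yI.
(* Only moves of [y] to the left, and of [x] to the right, are surely admissible at this stage. Both
   inequalities point the same way because [phi x t] enters the two-point function with a minus
   sign. *)
have slope_y : barrier_x a rho b s y t <= phix y t.
  rewrite -subr_ge0.
  apply: (@left_max_derive_ge0 _ (fun y => phi y t - B y t) y).
  have := lt_nbhsr xy'; apply: filterS => y' xy'' yy'.
  have := Zle x y' t xr (ltW xy'') (le_trans yy' yr) tt; rewrite /Z/=; lra.
have slope_x : barrier_x a rho b s x t <= phix x t.
  rewrite -subr_le0.
  apply: (@right_max_derive_le0 _ (fun x => B x t - phi x t) x).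
  have := lt_nbhsl xy'; apply: filterS => x' xx' xy''.
  have := Zle x' y t (le_trans xr xy'') (ltW xx') yr tt; rewrite /Z/=; lra.
(* At [x = - r] the barrier slope is at least [L], so [slope_x] would contradict [phix < L]; the
   same argument excludes [y = r] and [t = s1]. *)
have x_int : - r < x.
  rewrite lt_neqAle xr andbT; apply/eqP => E.
  have := Kbd t tt x; rewrite -E normrN gtr0_norm// => /(_ erefl).
  by rewrite E => /le_trans/(_ slope_x); rewrite leNgt phixL//; lra.
have y_int : y < r.
  rewrite lt_neqAle yr andbT; apply/eqP => E.
  have := Kbd t tt y; rewrite E gtr0_norm// => /(_ erefl).
  by rewrite -E => /le_trans/(_ slope_y); rewrite leNgt phixL//; lra.
have s1t : s1 < t.
  rewrite lt_neqAle; case/andP: (tt) => -> _; rewrite andbT; apply/eqP => E.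
  have := Kini x; rewrite E => /le_trans/(_ slope_x).
  by rewrite leNgt phixL//; lra.
have max_y : \forall y' \near y, phi y' t - B y' t <= phi y t - B y t.
  near=> y'; have := Zle x y' t xr; rewrite /Z/= => h.
  have : x <= y' by near: y'; exact: lt_le_nbhsr.
  have : y' <= r by near: y'; exact: lt_le_nbhsl.
  by move=> h1 h2; have := h h2 h1 tt; lra.
have max_x : \forall x' \near x, B x' t - phi x' t <= B x t - phi x t.
  near=> x'; have := Zle x' y t; rewrite /Z/= => h.
  have : x' <= y by near: x'; exact: lt_le_nbhsl.
  have : - r <= x' by near: x'; exact: lt_le_nbhsr.
  by move=> h1 h2; have := h h1 h2 yr tt; lra.
have eq_y : phix y t = barrier_x a rho b s y t.
  apply/eqP; rewrite -subr_eq0; apply/eqP.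
  exact: (max_derive_eq0 _ (fun y => phi y t - B y t) y _ (is_derive_sub dphiy dBy) max_y).
have eq_x : phix x t = barrier_x a rho b s x t.
  apply/esym/eqP; rewrite -subr_eq0; apply/eqP.
  exact: (max_derive_eq0 _ (fun x => B x t - phi x t) x _ (is_derive_sub dBx dphix) max_x).
have nI x' : - r < x' < r -> \forall z \near x', - rho < z < rho.
  move=> /andP[h1 h2]; near=> z; have : - rho < z by near: z; apply: lt_nbhsr; lra.
  have : z < rho by near: z; apply: lt_nbhsl; lra.
  by move=> -> ->.
have curv_y : phixx y t <= barrier_xx a rho y.
  rewrite -subr_le0.
  refine (max_derive2_le0 _ (fun y => phi y t - B y t)
    (fun y => phix y t - barrier_x a rho b s y t) y _ _
    (is_derive_sub (is_derive2_log_pressure Sy)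
      (is_derive_barrier_x _ _ _ _ _ t yI)) max_y).
  have := nI y ltac:(lra); apply: filterS => z zI.
  exact: (is_derive_sub (is_derive_log_pressure (sol z t zI tI))
    (is_derive_barrier _ _ _ _ _ t zI)).
have curv_x : barrier_xx a rho x <= phixx x t.
  rewrite -subr_le0.
  refine (max_derive2_le0 _ (fun x => B x t - phi x t)
    (fun x => barrier_x a rho b s x t - phix x t) x _ _
    (is_derive_sub (is_derive_barrier_x _ _ _ _ _ t xI)
      (is_derive2_log_pressure Sx)) max_x).
  have := nI x ltac:(lra); apply: filterS => z zI.
  exact: (is_derive_sub (is_derive_barrier _ _ _ _ _ t zI)
    (is_derive_log_pressure (sol z t zI tI))).
have [hx [dhx hxE]] := log_pressure_evolution Sx.
have [hy [dhy hyE]] := log_pressure_evolution Sy.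
have dBtx := is_derive_barrier_t a rho b s x t st.
have dBty := is_derive_barrier_t a rho b s y t st.
(* The maximum is compared with earlier times only, since [t] may be the final time; the
   continuations [hx] and [hy] agree with [phi] there. *)
have time : 0 <= ((p - 1) * P y t * phixx y t + (m * (1 + d) - p * P y t) * phix y t ^+ 2)
   - ((p - 1) * P x t * phixx x t + (m * (1 + d) - p * P x t) * phix x t ^+ 2)
   - (- (b / Num.sqrt (t - s) / (2 * (t - s)) * y)
      - - (b / Num.sqrt (t - s) / (2 * (t - s)) * x)).
  refine (left_max_derive_ge0 _ (fun t => hy t - hx t - (B y t - B x t)) t _
    (is_derive_sub (is_derive_sub dhy dhx) (is_derive_sub dBty dBtx)) _).
  have := lt_nbhsr s1t; apply: filterS => t' s1t' t't.
  have stt : s <= t <= t by rewrite lexx andbT ltW.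
  have stt' : s <= t' <= t by rewrite (ltW (lt_trans ss1 s1t')) t't.
  rewrite !hxE// !hyE//.
  have t'I : s1 <= t' <= t1 by rewrite (ltW s1t') (le_trans t't)//; case/andP: tI.
  have := Zle x y t' xr xy yr t'I; rewrite /Z/=; clear; lra.
move: time; rewrite eq_x eq_y => time.
apply: (barrier_contradiction _ p m d a b rho s t x y (P x t) (P y t)
  (phixx x t) (phixx y t) _ p1 m0 d0 b0 aE bE rho0 _ xy' _ st _ _ erefl
  _ curv_y curv_x time).
- by case/andP: xI.
- by case/andP: yI.
- by rewrite (pressure_ge0 Sx) (pressure_le Sx).
- by rewrite (pressure_ge0 Sy) (pressure_le Sy).
- move=> I0; apply: (log_pressure_gap _ m d _ _ (phi x t) (phi y t)) => //.
  + exact: pressure_le Sx.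
  + exact: pressure_le Sy.
  + exact: log_pressureE Sx.
  + exact: log_pressureE Sy.
  + by rewrite -subr_ge0; apply: ltW.
Unshelve. all: by end_near. Qed.

(** * The slope estimate on an interval *)

(** The qualitative bound [L] serves only to choose [r] and [s1], and disappears from the
    conclusion. Comparing the points 0 and y > 0 shows that [phi] minus the barrier has a maximum
    from the right at 0. *)
Lemma log_pressure_slope_le (R : realType) (p m d a b rho L s t1 : R)
    (P phi phix phixx : R -> R -> R) :
  1 < p -> 0 < m -> 0 < d -> 0 < b ->
  a = 96 * (1 + d) / d -> b ^+ 2 * (p * d * m) = 4 ->
  0 < rho -> s < t1 ->
  (forall x t, - rho < x < rho -> s < t <= t1 ->
    log_pressure_at p m d rho s t1 P phi phix phixx x t) ->
  (forall x t, - rho < x < rho -> s < t <= t1 -> phix x t < L) ->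
  phix 0 t1 <= barrier_x a rho b s 0 t1.
Proof.
move=> p1 m0 d0 b0 aE bE rho0 st sol; wlog L0 : L / 0 < L.
  move=> H phixL; apply: (H (Num.max L 1)); first by rewrite lt_max ltr01 orbT.
  by move=> x t xI tI; rewrite lt_max phixL.
move=> phixL.
have a0 : 0 < a by rewrite aE divr_gt0// mulr_gt0// addr_gt0.
(* With [r = rho - e^-1] the first part of the barrier slope at [r] is at least
   [a * rho / 2 * e ^+ 2]. In [e], the summand 1 gives [e <= e ^+ 2], the summand [c] makes the
   slope reach [L], and [2 / rho] keeps [r] positive. *)
pose c := 2 * L / (a * rho).
have c0 : 0 < c by rewrite divr_gt0// mulr_gt0.
pose e := 1 + c + 2 / rho.
have e20 : 0 < 2 / rho by rewrite divr_gt0.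
have e0 : 0 < e by rewrite !addr_gt0.
pose r := rho - e^-1.
have er : e^-1 <= rho / 2.
  by rewrite -[rho / 2]invf_div lef_pV2 ?posrE// lerDr addr_ge0// ltW.
have r0 : 0 < r by rewrite /r; move: (rho / 2) (splitr rho) er rho0 => h ->; lra.
have rr : r < rho by rewrite /r ltrBlDr ltrDl invr_gt0.
have Kr t : s < t -> L <= barrier_x a rho b s r t.
  move=> st'; rewrite /barrier_x /r subKr invrK.
  apply: (@le_trans _ _ (a * rho / 2 * c)).
    suff -> : a * rho / 2 * c = L by [].
    by rewrite /c; field; rewrite !gt_eqF.
  rewrite -[X in X <= _]addr0 lerD ?divr_ge0 ?sqrtr_ge0 ?(ltW b0)//.
  rewrite ler_wpM2l ?divr_ge0 ?mulr_ge0 ?ltW// ltr_wpDr ?exprn_even_ge0//.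
  have : 1 * e <= e * e by rewrite ler_pM2r// /e -addrA lerDl addr_ge0// ltW.
  by rewrite -expr2 mul1r; apply: lt_le_trans; rewrite /e; lra.
(* The first entry of the minimum ensures [s1 <= t1]; the second makes [Num.sqrt (s1 - s)] at most
   [b / L]. *)
pose s1 := s + Num.min (t1 - s) ((b / L) ^+ 2).
have bL : 0 < b / L by rewrite divr_gt0.
have ss1 : s < s1 by rewrite ltrDl lt_min subr_gt0 st exprn_gt0.
have s1t : s1 <= t1 by rewrite /s1 -lerBrDl ge_min lexx.
have Ks1 : L <= b / Num.sqrt (s1 - s).
  have q0 : 0 < Num.sqrt (s1 - s) by rewrite sqrtr_gt0 subr_gt0.
  rewrite ler_pdivlMr// mulrC -ler_pdivlMr// -[leRHS]ger0_norm ?(ltW bL)// -sqrtr_sqr.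
  by rewrite ler_wsqrtr// /s1 addrC addKr ge_min lexx orbT.
have phixL' x t : - r <= x <= r -> s1 <= t <= t1 -> phix x t < L.
  move=> /andP[h1 h2] /andP[h3 h4]; apply: phixL; apply/andP; split.
  - by apply: lt_le_trans h1; rewrite ltrN2.
  - exact: le_lt_trans rr.
  - exact: lt_le_trans h3.
  - exact: h4.
have key := @two_point_maximum_principle _ p m d a b rho r L s s1 t1 P phi phix
  phixx p1 m0 d0 b0 aE bE r0 rr ss1 s1t sol phixL' Kr Ks1.
have I0 : - rho < 0 < rho by rewrite oppr_lt0 rho0.
have It : s < t1 <= t1 by rewrite st lexx.
rewrite -subr_le0.
refine (right_max_derive_le0 _ (fun x => phi x t1 - barrier a rho b s x t1) 0 _
  (is_derive_sub (is_derive_log_pressure (sol 0 t1 I0 It))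
    (is_derive_barrier _ _ _ _ _ _ I0)) _).
have := lt_nbhsl r0; apply: filterS => y yr y0.
have := key 0 y t1; rewrite lerBlDr => h.
rewrite lerBlDr (le_trans (h _))//; last by rewrite addrAC -addrA addrC; lra.
by split => /=; rewrite ?oppr_le0 ?(ltW r0) ?(ltW yr) ?s1t ?lexx.
Qed.

Lemma is_derive_continuous (R : realType) (f : R -> R) (x df : R) :
  is_derive x 1 f df -> {for x, continuous f}.
Proof. by move=> [d _]; exact/differentiable_continuous/derivable1_diffP. Qed.

Lemma has_derivative_withinW (R : realType) (A B : set R) (f : R -> R) (t l : R) :
  A `<=` B -> has_derivative_within B f t l -> has_derivative_within A f t l.
Proof.
move=> AB fl W /fl h; apply: (@filterS _ (t^') _ _ _ _ h) => z Wz Az.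
exact/Wz/AB.
Qed.

(** The time derivative in the hypotheses is (v^p)_xx expanded. The substitution phi = - ln (alpha -
    G(v)), whose derivative in v is [psi], turns it into the evolution of [log_pressure_at]; the
    left side of the conclusion is the slope of phi at the centre. *)
Lemma pme_slope_le (R : realType) (p M d a b r rho s t1 : R)
    (v vx vxx : R -> R -> R) :
  1 < p -> 0 < M -> 0 < d -> 0 < b ->
  let G := fun z : R => p / (p - 1) * z `^ (p - 1) in
  a = 96 * (1 + d) / d -> b ^+ 2 * (p * d * G M) = 4 ->
  0 < rho -> rho < r -> s < t1 ->
  (forall x t, - r < x < r -> s <= t <= t1 ->
    [/\ 0 < v x t, v x t <= M, is_derive x 1 (v ^~ t) (vx x t) &
        is_derive x 1 (vx ^~ t) (vxx x t)]) ->
  (forall x t, - r < x < r -> s < t <= t1 ->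
    has_derivative_within `[s, t] (v x) t
      (p * v x t `^ (p - 1) * vxx x t
       + p * (p - 1) * v x t `^ (p - 2) * vx x t ^+ 2)) ->
  let D := [set z : R * R | - r < z.1 < r /\ s <= z.2 <= t1] in
  {within D, continuous (fun z => v z.1 z.2)} ->
  {within D, continuous (fun z => vx z.1 z.2)} ->
  p * v 0 t1 `^ (p - 2) * vx 0 t1 / (G M * (1 + d) - G (v 0 t1))
    <= barrier_x a rho b s 0 t1.
Proof.
move=> p1 M0 d0 b0 G aE bE rho0 rr st sol time D cv cvx.
have pp : 0 < p / (p - 1) by rewrite divr_gt0//; lra.
have G0 (z : R) : 0 < z -> 0 < G z by move=> z0; rewrite mulr_gt0// powR_gt0.
have GM (z : R) : 0 < z -> z <= M -> G z <= G M.
  move=> z0 zM; rewrite ler_wpM2l ?(ltW pp)// ge0_ler_powR ?nnegrE ?(ltW z0) ?(ltW M0)//; lra.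
pose al := G M * (1 + d).
have alG (z : R) : 0 < z -> z <= M -> 0 < al - G z.
  move=> z0 zM; have := GM z z0 zM; have : 0 < G M * d by rewrite mulr_gt0// G0.
  rewrite /al; lra.
have powE (z k : R) : 0 < z -> z `^ (k + 1) = z `^ k * z.
  by move=> z0; rewrite powRD ?powRr1 ?(ltW z0)// (gt_eqF z0) implybT.
have dG (z : R) : 0 < z -> is_derive z 1 G (p * z `^ (p - 2)).
  move=> z0; have := is_derive1_powR (p - 1) z0 => dpow.
  have := is_deriveZ (p / (p - 1)) dpow; rewrite /GRing.scale/=.
  have -> : p - 1 - 1 = p - 2 by ring.
  by rewrite mulrA divfK// gt_eqF// subr_gt0.
have dPhi (z : R) : 0 < z -> z <= M ->
    is_derive z 1 (fun z => - ln (al - G z)) (p * z `^ (p - 2) / (al - G z)).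
  move=> z0 zM; have dl := is_derive1_ln (alG z z0 zM).
  have dal : is_derive z 1 (fun z => al - G z) (0 - p * z `^ (p - 2)).
    exact: (is_derive_sub (is_derive_cst al z 1) (dG z z0)).
  have := is_deriveN (@is_derive1_comp _ (@ln R) (fun z => al - G z) z _ _ dl dal).
  by rewrite sub0r mulrN opprK mulrC.
pose psi z := p * z `^ (p - 2) / (al - G z).
have dpsi (z : R) : 0 < z -> z <= M -> is_derive z 1 psi
    (p * (p - 2) * z `^ (p - 3) / (al - G z) + (p * z `^ (p - 2) / (al - G z)) ^+ 2).
  move=> z0 zM; have A0 : al - G z != 0 by rewrite gt_eqF// alG.
  have dpow : is_derive z 1 (fun z => p * z `^ (p - 2)) (p * ((p - 2) * z `^ (p - 3))).
    have := is_deriveZ p (is_derive1_powR (p - 2) z0); rewrite /GRing.scale/=.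
    by have -> : p - 2 - 1 = p - 3 by ring.
  have dal : is_derive z 1 (fun z => al - G z) (0 - p * z `^ (p - 2)).
    exact: (is_derive_sub (is_derive_cst al z 1) (dG z z0)).
  have := is_deriveM dpow (@is_deriveV _ (fun z => al - G z) z _ 1 A0 dal).
  rewrite /GRing.scale/=; move/is_derive_eq; apply; rewrite /=.
  by field.
pose P x t := G (v x t).
pose phi x t := - ln (al - P x t).
pose phix x t := psi (v x t) * vx x t.
pose phixx x t := (p * (p - 2) * v x t `^ (p - 3) / (al - P x t)
   + psi (v x t) ^+ 2) * vx x t * vx x t + psi (v x t) * vxx x t.
have box (x : R) : - rho < x < rho -> - r < x < r by move=> /andP[??]; lra.
(* As [rho < r], the closed cylinder of half-width [rho] is a compact part of [D], and [phix] is
   continuous on it up to time [s]. *)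
have [L HL] : exists L, forall x t, - rho < x < rho -> s < t <= t1 -> phix x t < L.
  have sub : `[- rho, rho] `*` `[s, t1] `<=` D.
    move=> [x t] [/=]; rewrite !in_itv/= => /andP[??] tI; split => //=; lra.
  have cphix : {within `[- rho, rho] `*` `[s, t1], continuous (fun z => phix z.1 z.2)}.
    apply/subspace_continuousP => -[x t] xtI.
    have [/= xI tI] := sub _ xtI; have [v0 vM _ _] := sol x t xI tI.
    have /subspace_continuousP/(_ _ xtI) c1 := continuous_subspaceW sub cv.
    have /subspace_continuousP/(_ _ xtI) c2 := continuous_subspaceW sub cvx.
    apply: cvgM; last exact: c2.
    exact: (cvg_comp _ psi c1 (is_derive_continuous _ _ _ _ (dpsi _ v0 vM))).
  have [||c _ cmax] := compact_EVT_max _ _ cphix.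
  - by exists (0, t1); split => /=; rewrite in_itv/= ?(ltW st) ?lexx// oppr_le0 !ltW.
  - by apply: compact_setX; exact: segment_compact.
  exists (phix c.1 c.2 + 1) => x t /andP[x1 x2] /andP[ts tt].
  apply: (le_lt_trans (cmax (x, t) _)); last by rewrite ltrDl.
  by rewrite inE; split => /=; rewrite in_itv/= ?tt ?andbT ltW ?(ltW x2).
have H : p * v 0 t1 `^ (p - 2) * vx 0 t1 / (al - G (v 0 t1)) = phix 0 t1.
  by rewrite /phix /psi mulrAC.
rewrite -/al H.
apply: (@log_pressure_slope_le _ p (G M) d a b rho L s t1 P phi phix phixx) => //.
  exact: G0.
move=> x t xI' tI; have xI := box x xI'.
have tI' : s <= t <= t1 by case/andP: tI => /ltW -> ->.
have [v0 vM dv dvx] := sol x t xI tI'.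
split.
- by rewrite ltW// G0.
- exact: GM.
- by [].
- exact: (@is_derive1_comp _ (fun z => - ln (al - G z)) (v ^~ t) x _ _ (dPhi _ v0 vM) dv).
- have d1 := @is_derive1_comp _ psi (v ^~ t) x _ _ (dpsi _ v0 vM) dv.
  have := is_deriveM d1 dvx; rewrite /GRing.scale/=.
  by move/is_derive_eq; apply; rewrite /phixx /psi /P/=; ring.
- have st' : s < t by case/andP: tI.
  have [h [dh hE]] := within_derivative_extension _ _ _ _ _ st' (time x t xI tI).
  exists (fun t' => - ln (al - G (h t'))); split.
    have ht : h t = v x t by exact: hE.
    have dPh := dPhi _ v0 vM; rewrite -{1}ht in dPh.
    have := @is_derive1_comp _ (fun z => - ln (al - G z)) h t _ _ dPh dh.
    move/is_derive_eq; apply.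
    (* All powers are written through v^(p - 3), and [al] through the difference [A], which leaves a
       rational identity for [field]. *)
    have e2 : v x t `^ (p - 2) = v x t `^ (p - 3) * v x t.
      by rewrite -powE//; congr (_ `^ _); ring.
    have e1 : v x t `^ (p - 1) = v x t `^ (p - 3) * v x t * v x t.
      by rewrite -e2 -powE//; congr (_ `^ _); ring.
    have A0 := alG _ v0 vM; have p10 : p - 1 != 0 by rewrite gt_eqF// subr_gt0.
    rewrite /phixx /phix /psi /P -/al.
    have alE : al = (al - G (v x t)) + G (v x t) by rewrite subrK.
    rewrite [X in X - p * G _]alE.
    move: (al - G (v x t)) A0 => A A0; rewrite /G e1 e2.
    by field; rewrite p10 gt_eqF.
  by move=> t' /andP[_ t't]; rewrite hE.
- have sub : [set z : R * R | - rho < z.1 < rho /\ s <= z.2 <= t1] `<=` D.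
    by move=> z [/box h1 h2]; split.
  have xtI : [set z : R * R | - rho < z.1 < rho /\ s <= z.2 <= t1] (x, t).
    by split.
  have /subspace_continuousP/(_ _ xtI) c1 := continuous_subspaceW sub cv.
  exact: (cvg_comp _ (fun z => - ln (al - G z)) c1
    (is_derive_continuous _ _ _ _ (dPhi _ v0 vM))).
Qed.

(** * Geodesics *)

(* [coord] is otherwise the coordinate function of vector spaces. *)
Local Notation coord := Defs.coord.

Lemma near_cdom (R : realType) (X : riemannian1 R) (i : chart X) (c : R -> X) (t : R) :
  {for t, continuous c} -> cdom X i (c t) -> \forall s \near t, cdom X i (c s).
Proof.
by move=> cc ci; apply: cc; apply: open_nbhs_nbhs; split => //; exact: cdom_open.
Qed.

Lemma is_derive_derive1 (R : realType) (f : R -> R) (x : R) :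
  derivable f x 1 -> is_derive x 1 f (derive1 f x).
Proof. by move=> df; rewrite derive1E; exact: derivableP. Qed.

Lemma is_derive_derive1E (R : realType) (f : R -> R) (x d : R) :
  is_derive x 1 f d -> derive1 f x = d.
Proof. by move=> df; rewrite derive1E derive_val. Qed.

Lemma chart_change (R : realType) (X : riemannian1 R) (i j : chart X)
    (c : R -> X) (t : R) :
  {for t, continuous c} -> cdom X i (c t) -> cdom X j (c t) ->
  derivable (coord X i \o c) t 1 ->
  is_derive t 1 (coord X j \o c)
    (derive1 (coord X j \o param X i) (coord X i (c t)) * derive1 (coord X i \o c) t).
Proof.
move=> cc ci cj dy.
have tr : derivable (coord X j \o param X i) (coord X i (c t)) 1.
  by apply: (@transition_smooth _ X i j 0%N); exists (c t).
apply: near_eq_is_derive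
  (is_derive1_comp (is_derive_derive1 _ _ _ tr) (is_derive_derive1 _ _ _ dy)).
have := near_cdom _ X i c t cc ci; apply: filterS => s si /=.
by rewrite coordK.
Qed.

(** The square of [speed]; without root and absolute value it can be differentiated directly. *)
Definition energy {R : realType} (X : riemannian1 R) (c : R -> X) (t : R) : R :=
  let i := chart_at X (c t) in
  metric X i (coord X i (c t)) * derive1 (coord X i \o c) t ^+ 2.

(** The Jacobian of the change of charts cancels against the transformation law of the metric. A
    chart that stays fixed near [t], unlike the one chosen in [energy], permits differentiation. *)
Lemma energyE (R : realType) (X : riemannian1 R) (c : R -> X) (t : R) (i : chart X) :
  geodesic c -> cdom X i (c t) ->
  energy X c t = metric X i (coord X i (c t)) * derive1 (coord X i \o c) t ^+ 2.
Proof.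
move=> [cc gc] ci; rewrite /energy; set j := chart_at X (c t).
have cj : cdom X j (c t) by exact: chart_atP.
have [dy _ _] := gc t i ci.
rewrite (is_derive_derive1E _ _ _ _ (chart_change _ X i j c t (cc t) ci cj dy)).
by rewrite (metric_transition ci cj) exprMn mulrA.
Qed.

(** In a chart the derivative is g' y'^3 + 2 g y' y'', which the geodesic equation makes zero. *)
Lemma energy_cst (R : realType) (X : riemannian1 R) (c : R -> X) (t : R) :
  geodesic c -> energy X c t = energy X c 0.
Proof.
move=> gc; apply: is_derive_0_is_cst => {}t.
have [cc geq] := gc; set i := chart_at X (c t).
have ci : cdom X i (c t) by exact: chart_atP.
have nE : \forall s \near t,
    metric X i ((coord X i \o c) s) * derive1 (coord X i \o c) s ^+ 2 = energy X c s.
  have := near_cdom _ X i c t (cc t) ci; apply: filterS => s si.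
  by rewrite -energyE.
apply: near_eq_is_derive nE _.
have [dy ddy] := geq t i ci; move: dy ddy.
set y := coord X i \o c; set g := metric X i => dy ddy.
have Vy : (coord X i @` cdom X i) (y t) by exists (c t).
have g0 : 0 < g (y t) by exact: metric_gt0.
have dg : derivable g (y t) 1 by exact: (@metric_smooth _ X i 0%N).
rewrite derive1nS derive1n1 => eqn.
have d1 := is_derive1_comp (is_derive_derive1 _ _ _ dg) (is_derive_derive1 _ _ _ dy).
have d2 := is_deriveX 2 (is_derive_derive1 _ _ _ ddy).
have d3 : is_derive t 1 (fun s => g (y s) * derive1 y s ^+ 2) _ := is_deriveM d1 d2.
apply: (is_derive_eq d3); rewrite /GRing.scale/= ?expr1.
move/eqP : eqn; rewrite addr_eq0 => /eqP ->.
have -> : (derive1 y ^+ 2) t = derive1 y t ^+ 2 by [].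
by field; rewrite gt_eqF.
Qed.

Lemma is_derive_scale_arg (R : realType) (f : R -> R) (s t df : R) :
  is_derive (s * t) 1 f df -> is_derive t 1 (fun x => f (s * x)) (s * df).
Proof.
move=> fd; have ds : is_derive t 1 (fun x : R => s * x) (s * 1).
  exact: (is_deriveZ s (is_derive_id t 1)).
have := @is_derive1_comp _ f (fun x => s * x) t _ _ fd ds.
by rewrite mulr1 mulrC.
Qed.

(** The reparametrisation of the segment by [c (s * t)] on [0, 1] has constant speed [|s|], for
    either sign of [s]. *)
Lemma path_length_geodesic (R : realType) (X : riemannian1 R) (c : R -> X) (s : R) :
  geodesic c -> (forall t, energy X c t = 1) ->
  path_length (c 0) (c s) `|s|%:E.
Proof.
move=> gc E1; have [cc geq] := gc.
pose c' t := c (s * t).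
have mulc : continuous (fun t : R => s * t).
  by move=> t; apply: cvgM; [exact: cvg_cst|exact: cvg_id].
have cc' : continuous c'.
  by move=> t; apply: (cvg_comp (fun t : R => s * t) c); [exact: mulc|exact: cc].
have der t i : cdom X i (c' t) -> is_derive t 1 (coord X i \o c')
    (s * derive1 (coord X i \o c) (s * t)).
  move=> ci; have [dy _ _] := geq _ i ci.
  exact: (@is_derive_scale_arg _ (coord X i \o c) s t _ (is_derive_derive1 _ _ _ dy)).
have C1 t : 0 <= t <= 1 -> C1_curve_at c' t.
  move=> _; split; first exact: cc'.
  move=> i ci.
  have near_ci := near_cdom _ X i c' t (cc' t) ci.
  split.
    by apply: filterS near_ci => z zi; case: (der z i zi).
  have [_ ddy _] := geq _ i ci.
  have d1 := @is_derive_scale_arg _ (derive1 (coord X i \o c)) s t _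
    (is_derive_derive1 _ _ _ ddy).
  have := is_derive_continuous _ _ _ _ d1 => ct.
  suff : derive1 (coord X i \o c') z @[z --> t] --> derive1 (coord X i \o c') t by [].
  rewrite (is_derive_derive1E _ _ _ _ (der t i ci)).
  have : s * derive1 (coord X i \o c) (s * z) @[z --> t] --> s * derive1 (coord X i \o c) (s * t).
    by apply: cvgM; [exact: cvg_cst|exact: ct].
  apply: cvg_trans; apply: near_eq_cvg; apply: filterS near_ci => z zi.
  by rewrite (is_derive_derive1E _ _ _ _ (der z i zi)).
have speedE t : speed c' t = `|s|.
  rewrite /speed; have cj := @chart_atP _ X (c' t).
  set j := chart_at X (c' t) in cj *.
  rewrite (is_derive_derive1E _ _ _ _ (der t j cj)) normrM mulrCA.
  have := energyE _ X c (s * t) j gc cj; rewrite E1 => e.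
  have g0 : 0 < metric X j (coord X j (c' t)) by apply: metric_gt0; exists (c' t).
  rewrite -[X in _ * (_ * X)]sqrtr_sqr -sqrtrM ?(ltW g0)// -/(c' t).
  by move: e; rewrite -/(c' t) => <-; rewrite sqrtr1 mulr1.
have := path_C1 C1; rewrite /c' mulr0 mulr1.
under eq_integral do rewrite speedE.
rewrite integral_cst//= lebesgue_measure_itv/= lte_fin ltr01 oppr0 adde0 mule1.
by [].
Qed.

(** A path from [x0] to [c 0] shorter than r/2 is continued by the segment of the geodesic. *)
Lemma geodesic_ball_half (R : realType) (X : riemannian1 R) (x0 : X) (r : R)
    (c : R -> X) (s : R) :
  geodesic c -> (forall t, energy X c t = 1) ->
  geodesic_ball x0 (r / 2) (c 0) -> `|s| <= r / 2 -> geodesic_ball x0 r (c s).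
Proof.
move=> gc E1; rewrite /geodesic_ball/= => /ereal_inf_lt[l1 p1 l1r] sr.
have p2 := path_length_geodesic _ X c s gc E1.
apply: (le_lt_trans (ereal_inf_lbound (path_cat p1 p2))).
by rewrite [r in (_ < r%:E)%E](splitr r) EFinD lte_leD.
Qed.

(** A curve with nonzero derivative takes values on both sides of [y s] arbitrarily near [s], and by
    the intermediate value theorem covers a neighbourhood of [y s]. A property known along the
    geodesic thus becomes one on an open set of the chart. *)
Lemma open_image_near (R : realType) (y : R -> R) (s d : R) (Q : R -> Prop) :
  is_derive s 1 y d -> d != 0 -> (\forall z \near s, {for z, continuous y}) ->
  (\forall z \near s, Q (y z)) -> \forall z \near y s, Q z.
Proof.
move=> /is_derive1_caratheodory[g [gE gc gd]] d0 cy Qy.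
have gd0 : \forall z \near s, 0 < g z * d.
  have cgd : g z * d @[z --> s] --> g s * d by apply: cvgM; [exact: gc|exact: cvg_cst].
  by have /cvgr_gt := cgd; apply; rewrite gd -expr2 exprn_even_gt0.
have /nbhs_ballP[e /= e0 be] : \forall z \near s,
    [/\ {for z, continuous y}, Q (y z) & 0 < g z * d].
  by near=> z; split; near: z.
have inb z : z \in `[s - e / 2, s + e / 2]%R ->
    [/\ {for z, continuous y}, Q (y z) & 0 < g z * d].
  rewrite in_itv/= => /andP[h1 h2]; apply: be; rewrite /ball/= ltr_norml.
  by apply/andP; split; lra.
have e20 : 0 < e / 2 by rewrite divr_gt0.
have le : s - e / 2 <= s + e / 2 by lra.
have [_ _ g1] := inb (s - e / 2) ltac:(by rewrite in_itv/= lexx le).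
have [_ _ g2] := inb (s + e / 2) ltac:(by rewrite in_itv/= lexx le).
have E1 := gE (s - e / 2); have E2 := gE (s + e / 2).
rewrite (_ : s - e / 2 - s = - (e / 2)) in E1; last by ring.
rewrite (_ : s + e / 2 - s = e / 2) in E2; last by ring.
have ycont : {within `[s - e / 2, s + e / 2], continuous y}.
  apply: continuous_in_subspaceT => z; rewrite inE => zI.
  by have [] := inb z zI.
have : Num.min (y (s - e / 2)) (y (s + e / 2)) < y s
    < Num.max (y (s - e / 2)) (y (s + e / 2)).
  rewrite gt_min lt_max; move: d0; rewrite neq_lt => /orP[] d0.
    have gn1 : g (s - e / 2) < 0 by rewrite -(nmulr_lgt0 _ d0).
    have gn2 : g (s + e / 2) < 0 by rewrite -(nmulr_lgt0 _ d0).
    apply/andP; split; apply/orP; [right|left]; rewrite -subr_gt0.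
      by rewrite -opprB E2 oppr_gt0 nmulr_rlt0.
    by rewrite E1 nmulr_rgt0// oppr_lt0.
  have gn1 : 0 < g (s - e / 2) by rewrite -(pmulr_lgt0 _ d0).
  have gn2 : 0 < g (s + e / 2) by rewrite -(pmulr_lgt0 _ d0).
  apply/andP; split; apply/orP; [left|right]; rewrite -subr_gt0.
    by rewrite -opprB E1 oppr_gt0 pmulr_rlt0// oppr_lt0.
  by rewrite E2 mulr_gt0.
move=> /andP[m1 m2]; near=> z.
have zI : Num.min (y (s - e / 2)) (y (s + e / 2)) <= z
    <= Num.max (y (s - e / 2)) (y (s + e / 2)).
  by apply/andP; split; near: z; [exact: lt_le_nbhsr|exact: lt_le_nbhsl].
have [x xI <-] := IVT le ycont zI.
by have [] := inb x xI.
Unshelve. all: by end_near. Qed.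

(** In the chart, (w'' - g' w' / (2 g)) / g is the Laplacian of [f] and w'^2 / g its squared
    gradient; the formula is the chain rule for the Laplacian of f^p. *)
Lemma laplacian_powR (R : realType) (X : riemannian1 R) (f : X -> R) (x : X) (p : R) :
  let i := chart_at X x in let y := coord X i x in
  let w := f \o param X i in let g := metric X i in
  (\forall z \near y, 0 < w z /\ derivable w z 1) -> derivable (derive1 w) y 1 ->
  laplacian (fun x' => f x' `^ p) x =
  p * w y `^ (p - 1) * ((derive1 (derive1 w) y - derive1 g y / (2 * g y) * derive1 w y) / g y)
  + p * (p - 1) * w y `^ (p - 2) * (derive1 w y ^+ 2 / g y).
Proof.
move=> i y w g wn ddw.
have Vy : (coord X i @` cdom X i) y by exists x => //; exact: chart_atP.
have g0 : 0 < g y by exact: metric_gt0.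
have [w0 dw] := nbhs_singleton wn.
have dg := is_derive_derive1 _ _ _ (@metric_smooth _ X i 0%N _ Vy).
have d1 : is_derive y 1 (fun z => w z `^ (p - 1)) _ :=
  is_derive1_comp (is_derive1_powR (p - 1) w0) (is_derive_derive1 _ _ _ dw).
have d2 : is_derive y 1 (fun z => p * (w z `^ (p - 1) * derive1 w z)) _ :=
  is_deriveZ p (is_deriveM d1 (is_derive_derive1 _ _ _ ddw)).
have d3 : is_derive y 1 (fun z => Num.sqrt (g z)) _ :=
  is_derive1_comp (is_derive1_sqrt g0) dg.
have gn0 : g y != 0 by rewrite gt_eqF.
have d4 : is_derive y 1 (fun z => (g z)^-1) _ := @is_deriveV _ g y _ 1 gn0 dg.
have d5 : is_derive y 1 (fun z => Num.sqrt (g z) * (g z)^-1 *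
  (p * (w z `^ (p - 1) * derive1 w z))) _ := is_deriveM (is_deriveM d3 d4) d2.
rewrite /laplacian -/i -/y -/g.
have nE : \forall z \near y, Num.sqrt (g z) * (g z)^-1 *
    (p * (w z `^ (p - 1) * derive1 w z)) =
    Num.sqrt (g z) * (g z)^-1 * derive1 ((fun x' => f x' `^ p) \o param X i) z.
  apply: filterS wn => z [wz dwz]; congr (_ * _).
  have := is_derive1_comp (is_derive1_powR p wz) (is_derive_derive1 _ _ _ dwz).
  by move=> /is_derive_derive1E ->; rewrite mulrA.
rewrite (is_derive_derive1E _ _ _ _ (near_eq_is_derive nE d5)) /GRing.scale/=.
have -> : ((fun z => Num.sqrt (g z)) * (fun z => (g z)^-1)) y =
  Num.sqrt (g y) * (g y)^-1 by [].
have q0 : 0 < Num.sqrt (g y) by rewrite sqrtr_gt0.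
have qE := sqr_sqrtr (ltW g0).
have -> : p - 1 - 1 = p - 2 by ring.
move: (Num.sqrt (g y)) q0 qE => q q0 qE.
rewrite -/g -qE; field.
by rewrite gt_eqF.
Qed.

(** * The solution along a geodesic *)

Section Pullback.
Context {R : realType} (X : riemannian1 R) (p : R) (B : set X) (a b : R)
  (u : X -> R -> R) (c : R -> X) (r : R)
  (hu : positive_pme_solution p B a b u) (gc : geodesic c)
  (E1 : forall t, energy X c t = 1) (cB : forall s, - r < s < r -> B (c s)).

Let v (s t : R) : R := u (c s) t.
Let vx (s t : R) : R := derive1 (v ^~ t) s.
Let vxx (s t : R) : R := derive1 (vx ^~ t) s.
Let w i t y := u (param X i y) t.

Lemma geodesic_ball_mem s i : - r < s < r -> cdom X i (c s) ->
  (coord X i @` (cdom X i `&` B)) (coord X i (c s)).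
Proof. by move=> sr ci; exists (c s) => //; split => //; exact: cB. Qed.

Lemma near_ball s : - r < s < r -> \forall z \near s, - r < z < r.
Proof.
by move=> /andP[h1 h2]; near=> z; apply/andP; split; near: z;
  [exact: lt_nbhsr|exact: lt_nbhsl].
Unshelve. all: by end_near. Qed.

Lemma pullback_chart s t i : - r < s < r -> a <= t <= b -> cdom X i (c s) ->
  is_derive s 1 (v ^~ t)
    (derive1 (w i t) (coord X i (c s)) * derive1 (coord X i \o c) s).
Proof.
move=> sr tI ci; have [_ [ut [[_ /(_ i)[reg _]] _]]] := hu.
have [dw _] := reg _ _ tI (geodesic_ball_mem s i sr ci).
have [dy _ _] := gc.2 s i ci.
have := @is_derive1_comp _ (w i t) (coord X i \o c) s _ _
  (is_derive_derive1 _ _ _ dw) (is_derive_derive1 _ _ _ dy).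
apply: near_eq_is_derive; have := near_cdom _ X i c s (gc.1 s) ci.
by apply: filterS => z zi; rewrite /v /w /= coordK.
Qed.

(** The formula of [pullback_chart] holds in one fixed chart throughout a neighbourhood of [s], so
    the product rule applies to it. *)
Lemma pullback_chart2 s t i : - r < s < r -> a <= t <= b -> cdom X i (c s) ->
  is_derive s 1 (vx ^~ t)
    (derive1 (derive1 (w i t)) (coord X i (c s)) * derive1 (coord X i \o c) s ^+ 2
     + derive1 (w i t) (coord X i (c s)) * derive1 (derive1 (coord X i \o c)) s).
Proof.
move=> sr tI ci; have [_ [ut [[_ /(_ i)[reg _]] _]]] := hu.
have [_ ddw] := reg _ _ tI (geodesic_ball_mem s i sr ci).
have [dy ddy _] := gc.2 s i ci.
have d1 := @is_derive1_comp _ (derive1 (w i t)) (coord X i \o c) s _ _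
  (is_derive_derive1 _ _ _ ddw) (is_derive_derive1 _ _ _ dy).
have d2 : is_derive s 1 (fun z => derive1 (w i t) (coord X i (c z)) *
  derive1 (coord X i \o c) z) _ := is_deriveM d1 (is_derive_derive1 _ _ _ ddy).
have nE : \forall z \near s, derive1 (w i t) (coord X i (c z)) *
  derive1 (coord X i \o c) z = vx z t.
  have := near_cdom _ X i c s (gc.1 s) ci.
  apply: filterS2 (near_ball s sr) => z zr zi.
  by rewrite /vx (is_derive_derive1E _ _ _ _ (pullback_chart z t i zr tI zi)).
apply: (is_derive_eq (near_eq_is_derive nE d2)).
by rewrite /GRing.scale/= addrC [X in X + _]mulrC -mulrA -expr2.
Qed.

(** Unit speed gives y'^2 = 1/g, and the geodesic equation expresses y'' through y'^2; with these
    the chart formula of [laplacian_powR] becomes the flat one in the arc length [s]. *)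
Lemma pullback_evolution s t : - r < s < r -> a <= t <= b ->
  has_derivative_within `[a, b] (v s) t
    (p * v s t `^ (p - 1) * vxx s t + p * (p - 1) * v s t `^ (p - 2) * vx s t ^+ 2).
Proof.
move=> sr tI; have [upos [ut [[utd reg] eqn]]] := hu.
have Bs := cB s sr.
suff <- : ut (c s) t = p * v s t `^ (p - 1) * vxx s t
    + p * (p - 1) * v s t `^ (p - 2) * vx s t ^+ 2 by exact: utd.
rewrite (eqn _ _ Bs tI); set i := chart_at X (c s).
have ci : cdom X i (c s) by exact: chart_atP.
have Vy := geodesic_ball_mem s i sr ci.
have [dreg _] := reg i.
have [_ ddw] := dreg _ _ tI Vy.
have [dy ddy geq] := gc.2 s i ci.
have E := energyE _ X c s i gc ci; rewrite E1 in E.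
have g0 : 0 < metric X i (coord X i (c s)) by apply: metric_gt0; exists (c s).
have y0 : derive1 (coord X i \o c) s != 0.
  apply/eqP => y0; move: E; rewrite y0 expr0n/= mulr0 => /eqP.
  by rewrite oner_eq0.
have yn : \forall z \near s, {for z, continuous (coord X i \o c)}.
  have := near_cdom _ X i c s (gc.1 s) ci; apply: filterS => z zi.
  have [dz _ _] := gc.2 z i zi.
  exact: (is_derive_continuous _ _ _ _ (is_derive_derive1 _ _ _ dz)).
(* Differentiating in the chart requires positivity and regularity near the point; they are known
   along the geodesic, whose coordinate has nonzero derivative [y0]. *)
have wn : \forall z \near coord X i (c s),
    0 < w i t z /\ derivable (w i t) z 1.
  apply: (open_image_near _ (coord X i \o c) s _
    (fun z => 0 < w i t z /\ derivable (w i t) z 1)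
    (is_derive_derive1 _ _ _ dy) y0 yn).
  have := near_cdom _ X i c s (gc.1 s) ci.
  apply: filterS2 (near_ball s sr) => z zr zi; split.
    by rewrite /w /= coordK//; apply: upos => //; exact: cB.
  exact: (dreg _ _ tI (geodesic_ball_mem z i zr zi)).1.
rewrite (laplacian_powR _ X (u^~ t) (c s) p wn ddw) -/i.
rewrite /vxx (is_derive_derive1E _ _ _ _ (pullback_chart2 s t i sr tI ci)).
rewrite /vx (is_derive_derive1E _ _ _ _ (pullback_chart s t i sr tI ci)).
rewrite derive1nS derive1n1 in geq.
move/eqP : geq; rewrite addr_eq0 => /eqP ->.
have -> : v s t = w i t (coord X i (c s)) by rewrite /w coordK.
have yE : derive1 (coord X i \o c) s ^+ 2 = (metric X i (coord X i (c s)))^-1.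
  by apply: (mulfI (lt0r_neq0 g0)); rewrite -E divff// gt_eqF.
rewrite exprMn yE /= -/(w i t).
by field; rewrite gt_eqF.
Qed.

Let D := [set z : R * R | - r < z.1 < r /\ a <= z.2 <= b].

(** The change of variables that carries the joint continuity assumed in a chart over to arc length
    and time. *)
Lemma pullback_cvg s t i : - r < s < r -> a <= t <= b -> cdom X i (c s) ->
  (coord X i (c z.1), z.2) @[z --> within D (nbhs (s, t))] -->
  within [set z : R * R | (coord X i @` (cdom X i `&` B)) z.1 /\ a <= z.2 <= b]
    (nbhs (coord X i (c s), t)).
Proof.
move=> sr tI ci; apply: cvg_within_within.
  apply: (@cvg_pair _ _ _ _ (nbhs (coord X i (c s))) (nbhs t) _ _ _
    (fun z : R * R => coord X i (c z.1)) snd); last exact: cvg_snd.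
  have [dy _ _] := gc.2 s i ci.
  apply: (cvg_comp fst (coord X i \o c)); first exact: cvg_fst.
  exact: (is_derive_continuous _ _ _ _ (is_derive_derive1 _ _ _ dy)).
have : \forall z \near (s, t), cdom X i (c z.1).
  have cf : z.1 @[z --> (s, t)] --> s by exact: cvg_fst.
  exact: (cf _ (near_cdom _ X i c s (gc.1 s) ci)).
by apply: filterS => z zi [zr zt]; split => //; exact: geodesic_ball_mem.
Qed.

Lemma near_fst_cdom (s t : R) i : cdom X i (c s) ->
  \forall z \near within D (nbhs (s, t)), cdom X i (c z.1) /\ D z.
Proof.
move=> ci; rewrite near_withinE.
have cf : z.1 @[z --> (s, t)] --> s by exact: cvg_fst.
have h : \forall z \near (s, t), cdom X i (c z.1).
  exact: (cf _ (near_cdom _ X i c s (gc.1 s) ci)).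
by apply: filterS h => z zi Dz; split.
Qed.

Lemma pullback_continuous : {within D, continuous (fun z => v z.1 z.2)}.
Proof.
apply/subspace_continuousP => -[s t] [/= sr tI].
have [_ [ut [[_ reg] _]]] := hu; have [i ci] : exists i, cdom X i (c s).
  by exists (chart_at X (c s)); exact: chart_atP.
have [_ [+ _ _ _]] := reg i.
move/subspace_continuousP/(_ (coord X i (c s), t)) => cw.
have {}cw := cw (conj (geodesic_ball_mem s i sr ci) tI).
have h : w i z.2 (coord X i (c z.1)) @[z --> within D (nbhs (s, t))] -->
    w i t (coord X i (c s)) := cvg_comp _ _ (pullback_cvg s t i sr tI ci) cw.
have vE : w i t (coord X i (c s)) = v s t by rewrite /w coordK.
suff : v z.1 z.2 @[z --> within D (nbhs (s, t))] --> v s t by [].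
rewrite -vE; apply: cvg_trans h; apply: near_eq_cvg.
by apply: filterS (near_fst_cdom s t i ci) => z [zi _]; rewrite /v /w coordK.
Qed.

Lemma pullback_slope_continuous : {within D, continuous (fun z => vx z.1 z.2)}.
Proof.
apply/subspace_continuousP => -[s t] [/= sr tI].
have [_ [ut [[_ reg] _]]] := hu; have [i ci] : exists i, cdom X i (c s).
  by exists (chart_at X (c s)); exact: chart_atP.
have [_ [_ + _ _]] := reg i.
move/subspace_continuousP/(_ (coord X i (c s), t)) => cw.
have {}cw := cw (conj (geodesic_ball_mem s i sr ci) tI).
have c1 : derive1 (w i z.2) (coord X i (c z.1)) @[z --> within D (nbhs (s, t))] -->
    derive1 (w i t) (coord X i (c s)) := cvg_comp _ _ (pullback_cvg s t i sr tI ci) cw.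
have [_ ddy _] := gc.2 s i ci.
have c2 : derive1 (coord X i \o c) z.1 @[z --> within D (nbhs (s, t))] -->
    derive1 (coord X i \o c) s.
  apply: cvg_within_filter.
  apply: (cvg_comp fst (derive1 (coord X i \o c))); first exact: cvg_fst.
  exact: (is_derive_continuous _ _ _ _ (is_derive_derive1 _ _ _ ddy)).
have FF : Filter (within D (nbhs (s, t))) by exact: within_filter.
have h : derive1 (w i z.2) (coord X i (c z.1)) * derive1 (coord X i \o c) z.1
    @[z --> within D (nbhs (s, t))] -->
    derive1 (w i t) (coord X i (c s)) * derive1 (coord X i \o c) s := cvgM c1 c2.
have vE : vx s t = derive1 (w i t) (coord X i (c s)) * derive1 (coord X i \o c) s.
  by rewrite /vx (is_derive_derive1E _ _ _ _ (pullback_chart s t i sr tI ci)).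
suff : vx z.1 z.2 @[z --> within D (nbhs (s, t))] --> vx s t by [].
have e : \forall z \near within D (nbhs (s, t)),
    derive1 (w i z.2) (coord X i (c z.1)) * derive1 (coord X i \o c) z.1 = vx z.1 z.2.
  apply: (@filterS _ (within D (nbhs (s, t))) _ _ _ _ (near_fst_cdom s t i ci)).
  move=> z [zi [zr zt]].
  by rewrite /vx (is_derive_derive1E _ _ _ _ (pullback_chart z.1 z.2 i zr zt zi)).
rewrite vE; refine (cvg_trans (@near_eq_cvg _ _ _ FF _ _ e) _).
exact: h.
Qed.

Lemma pullback_derivable s t : - r < s < r -> a <= t <= b ->
  is_derive s 1 (v ^~ t) (vx s t) /\ is_derive s 1 (vx ^~ t) (vxx s t).
Proof.
move=> sr tI; have ci := @chart_atP _ X (c s).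
have d1 := pullback_chart s t _ sr tI ci; have d2 := pullback_chart2 s t _ sr tI ci.
by split; apply: is_derive_derive1; [case: d1|case: d2].
Qed.

End Pullback.

(** * The explicit constant and the final estimate *)

(** At the centre, with rho = r/4, the space part equals 384 (1 + d) / (d r), which fixes the
    constant. The time part is at most 4 / sqrt (N d T), because p^2 / (p - 1) >= 1 and
    [T / 2 <= t - s]. *)
Lemma barrier_x0_le (R : realType) (p N d r T s t : R) :
  1 < p -> 0 < N -> 0 < d -> 0 < r -> 0 < T -> T / 2 <= t - s ->
  barrier_x (96 * (1 + d) / d) (r / 4)
    (2 / Num.sqrt (p * d * (p / (p - 1) * N))) s 0 t
  <= 384 * ((1 + d) / (d * r) + 1 / Num.sqrt (N * d * T)).
Proof.
move=> p1 N0 d0 r0 T0 Tts.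
rewrite /barrier_x subr0 addr0 [leRHS]mulrDr lerD//.
  suff -> : 96 * (1 + d) / d * (r / 4) / 2 * ((r / 4)^-1 ^+ 2 + (r / 4)^-1 ^+ 2)
    = 384 * ((1 + d) / (d * r)) by [].
  by field; rewrite !gt_eqF.
have NdT : 0 < N * d * T by rewrite !mulr_gt0.
have ts0 : 0 < t - s by apply: lt_le_trans Tts; rewrite divr_gt0.
set Q := p * d * _.
have pp : 1 <= p * p / (p - 1).
  rewrite ler_pdivlMr ?subr_gt0// mul1r.
  have : 0 <= (p - 1) ^+ 2 by rewrite exprn_even_ge0.
  by rewrite expr2; lra.
have QE : Q = p * p / (p - 1) * (N * d) by rewrite /Q; ring.
clearbody Q; have Nd : N * d <= Q by rewrite QE ler_peMl// mulr_ge0// ltW.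
have Q0 : 0 < Q by apply: lt_le_trans Nd; rewrite mulr_gt0.
have -> : 2 / Num.sqrt Q / Num.sqrt (t - s) = 2 * (Num.sqrt (Q * (t - s)))^-1.
  by rewrite sqrtrM ?(ltW Q0)// invfM mulrA.
(* The factor 1/2 is weakened to 1/4, whose square root is rational. *)
have le1 : N * d * T / 4 <= Q * (t - s).
  apply: (@le_trans _ _ (N * d * (T / 2))).
    have -> : N * d * (T / 2) = N * d * T / 2 by rewrite mulrA.
    by rewrite ler_wpM2l ?(ltW NdT)// lef_pV2 ?posrE//; lra.
  by rewrite ler_pM ?mulr_ge0 ?divr_ge0 ?(ltW N0) ?(ltW d0) ?(ltW T0).
have q0 : 0 < Num.sqrt (N * d * T) by rewrite sqrtr_gt0.
have le2 : Num.sqrt (N * d * T) / 2 <= Num.sqrt (Q * (t - s)).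
  apply: (le_trans _ (ler_wsqrtr le1)).
  rewrite [leRHS]sqrtrM ?(ltW NdT)// ler_wpM2l ?(ltW q0)//.
  have -> : (4^-1 : R) = 2^-1 ^+ 2 by field.
  by rewrite sqrtr_sqr ger0_norm ?invr_ge0.
have le3 : (Num.sqrt (Q * (t - s)))^-1 <= 2 * (Num.sqrt (N * d * T))^-1.
  have -> : 2 * (Num.sqrt (N * d * T))^-1 = (Num.sqrt (N * d * T) / 2)^-1.
    by rewrite invf_div.
  by rewrite lef_pV2 ?posrE ?divr_gt0// sqrtr_gt0 mulr_gt0.
have : 0 < (Num.sqrt (N * d * T))^-1 by rewrite invr_gt0.
by move: le3; rewrite mul1r; lra.
Qed.

Theorem theorem1p4 (R : realType) (p : R) (hp : 1 < p) :
  exists C : R,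
    forall (X : riemannian1 R) (hX : complete_manifold X)
      (r T : R) (hr : 0 < r) (hT : 0 < T) (x0 : X) (t0 M : R) (hM : 0 < M)
      (u : X -> R -> R)
      (hu : positive_pme_solution p (geodesic_ball x0 r) (t0 - T) t0 u)
      (huM : forall z : X * R, cylinder x0 t0 r T z -> u z.1 z.2 <= M)
      (delta : R) (hdelta : 0 < delta),
    let G := fun v : R => p / (p - 1) * v `^ (p - 1) in
    let alpha := p / (p - 1) * M `^ (p - 1) * (1 + delta) in
    (ereal_sup [set (grad_norm (fun x => G (u x z.2)) z.1
                     / (alpha - G (u z.1 z.2)))%:E
               | z in cylinder x0 t0 (r / 2) (T / 2)]
     <= (C * ((1 + delta) / (delta * r)
              + 1 / Num.sqrt (M `^ (p - 1) * delta * T)))%:E)%E.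
Proof.
exists 384 => X hX r T hr hT x0 t0 M hM u hu huM delta hdelta.
pose G (z : R) := p / (p - 1) * z `^ (p - 1); pose alpha := G M * (1 + delta).
apply: ge_ereal_sup => _ [[x t] [/= xB /andP[tT tt0]] <-].
rewrite lee_fin.
set i := chart_at X x; set y := Defs.coord X i x; set g := metric X i y.
have ci : cdom X i x by exact: chart_atP.
have g0 : 0 < g by apply: metric_gt0; exists x.
have q0 : 0 < Num.sqrt g by rewrite sqrtr_gt0.
pose w y := u (param X i y) t.
(* the geodesic leaves [x] in the direction in which [u] increases *)
pose eps : R := if 0 <= derive1 w y then 1 else -1.
have eps2 : eps ^+ 2 = 1 by rewrite /eps; case: ifP => _; rewrite ?sqrrN expr1n.
have epsw : derive1 w y * eps = `|derive1 w y|.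
  rewrite /eps; case: ifPn => [/ger0_norm ->|]; first by rewrite mulr1.
  by rewrite -ltNge => /ltr0_norm ->; rewrite mulrN1.
(* Division by the root of the metric makes the initial velocity a unit vector; the energy is then 1
   at all times. *)
have [c [gc c0 cv]] := hX x (eps / Num.sqrt g).
have E1 s : energy X c s = 1.
  rewrite energy_cst// (energyE _ X c 0 i gc) c0// cv expr_div_n eps2.
  by rewrite sqr_sqrtr ?(ltW g0)// mul1r divff// gt_eqF.
have cB s : - (r / 2) < s < r / 2 -> geodesic_ball x0 r (c s).
  move=> sr; apply: geodesic_ball_half => //; first by rewrite c0.
  by rewrite ler_norml; case/andP: sr => /ltW -> /ltW ->.
have tI : t0 - T <= t <= t0.
  by rewrite tt0 andbT; apply: le_trans tT; rewrite lerD2l lerN2; lra.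
pose v s t := u (c s) t.
pose vx s t := derive1 (v ^~ t) s.
have v0 : v 0 t = u x t by rewrite /v c0.
have in0 : - (r / 2) < 0 < r / 2 by rewrite oppr_lt0 divr_gt0.
have ux0 : 0 < u x t.
  by have [pos _] := hu; apply: pos => //; have := cB 0 in0; rewrite c0.
have vx0 : vx 0 t = `|derive1 w y| / Num.sqrt g.
  have c0i : cdom X i (c 0) by rewrite c0.
  have d := pullback_chart X p _ _ _ u c (r / 2) hu gc cB 0 t i in0 tI c0i.
  by rewrite /vx (is_derive_derive1E _ _ _ _ d) c0 cv mulrA epsw.
have dw : is_derive y 1 w (derive1 w y).
  have [_ [ut [[_ /(_ i)[reg _]] _]]] := hu.
  apply: is_derive_derive1; apply: (reg _ _ tI _).1.
  by exists x => //; split => //; have := cB 0 in0; rewrite c0.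
have wy : w y = u x t by rewrite /w /y coordK.
have wy0 : 0 < w y by rewrite wy.
have gradE : grad_norm (fun x' => G (u x' t)) x = p * u x t `^ (p - 2) * vx 0 t.
  have dG : is_derive y 1 (fun z => p / (p - 1) * w z `^ (p - 1)) _ :=
    is_deriveZ (p / (p - 1)) (is_derive1_comp (is_derive1_powR (p - 1) wy0) dw).
  rewrite /grad_norm -/i -/y -/g (is_derive_derive1E _ _ _ _ dG) vx0 wy.
  have -> : p - 1 - 1 = p - 2 by ring.
  rewrite /GRing.scale/= !mulrA divfK ?gt_eqF ?subr_gt0// normrM ger0_norm//.
  by rewrite mulr_ge0 ?powR_ge0//; lra.
rewrite gradE -v0.
have N0 : 0 < M `^ (p - 1) by rewrite powR_gt0.
have Tt : T / 2 <= t - (t0 - T) by lra.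
apply: le_trans (barrier_x0_le _ p _ delta r T (t0 - T) t hp N0 hdelta hr hT Tt).
have GM0 : 0 < p * delta * G M.
  by rewrite !mulr_gt0// ?invr_gt0//; lra.
have subt : [set z : R * R | - (r / 2) < z.1 < r / 2 /\ t0 - T <= z.2 <= t] `<=`
    [set z : R * R | - (r / 2) < z.1 < r / 2 /\ t0 - T <= z.2 <= t0].
  by move=> z [z1 /andP[z2 z3]]; split => //; rewrite z2 (le_trans z3 tt0).
have inI t' : t0 - T <= t' <= t -> t0 - T <= t' <= t0.
  by move=> /andP[-> z3]; rewrite (le_trans z3 tt0).
(* The estimate is used at the centre of the geodesic segment and at the final time of the cylinder
   cut off at [t]. The solution is known for |s| < r/2; the barrier lives on the smaller half-width
   r/4. *)
apply: (@pme_slope_le _ p M delta _ _ (r / 2) (r / 4) (t0 - T) t v vx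
  (fun s t => derive1 (vx ^~ t) s) hp hM hdelta).
- by rewrite divr_gt0// sqrtr_gt0.
- by [].
- rewrite expr_div_n sqr_sqrtr ?(ltW GM0)// divfK ?gt_eqF//.
  by rewrite expr2 -natrM.
- by rewrite divr_gt0.
- lra.
- lra.
- move=> s t' sr /inI t'I.
  have [d1 d2] := pullback_derivable X p _ _ _ u c (r / 2) hu gc cB s t' sr t'I.
  split => //.
    by have [pos _] := hu; apply: pos => //; exact: cB.
  by apply: (huM (c s, t')); split => //; exact: cB.
- move=> s t' sr /andP[t'1 t'2].
  have t'I : t0 - T <= t' <= t0 by rewrite ltW// (le_trans t'2 tt0).
  apply: has_derivative_withinW
    (pullback_evolution X p _ _ _ u c (r / 2) hu gc E1 cB s t' sr t'I).
  move=> z/=; rewrite !in_itv/= => /andP[-> zt]; rewrite (le_trans zt)//.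
  by case/andP: t'I.
- exact: continuous_subspaceW subt (pullback_continuous X p _ _ _ u c (r / 2) hu gc cB).
- exact: continuous_subspaceW subt (pullback_slope_continuous X p _ _ _ u c (r / 2) hu gc cB).
Qed.
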